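(* Let $G$ be a (finite, simple) graph with $mad(G)<\frac{18}{7}$. Then $ch_3^d(G)\le 6$.
   Context: For a graph $G$ and an integer $r\ge 1$, an $r$-dynamic coloring of $G$ is a proper vertex coloring $\phi$ such that for every vertex $v$, the neighborhood $N_G(v)$ contains at least $\min\{r,\deg_G(v)\}$ distinct colors. Given a list assignment $L$ (a set $L(v)$ of colors for each vertex $v$), $G$ is $r$-dynamically $L$-colorable if it has an $r$-dynamic coloring $\phi$ with $\phi(v)\in L(v)$ for all $v$. $G$ is $r$-dynamically $k$-choosable if it is $r$-dynamically $L$-colorable for every list assignment $L$ with $|L(v)|\ge k$ for all $v$. The list $r$-dynamic chromatic number $ch_r^d(G)$ is the least $k$ such that $G$ is $r$-dynamically $k$-choosable. The maximum average degree $mad(G)$ is the maximum of $2|E(H)|/|V(H)|$ over all subgraphs $H$ of $G$ with at least one vertex. *)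

(* Defs.v *)
From mathcomp Require Import all_boot all_order all_algebra finmap boolp.

Set Implicit Arguments.
Unset Strict Implicit.
Unset Printing Implicit Defensive.

Record sgraph := SGraph {
  vertex :> finType;
  adj : rel vertex;
  adj_sym : symmetric adj;
  adj_irrefl : irreflexive adj }.

Section Graph.
Variable G : sgraph.

Definition neighbors (v : G) : {set G} := [set w | adj v w].

Definition degree (v : G) : nat := #|neighbors v|.

Definition edges : {set {set G}} :=
  [set [set p.1; p.2] | p in [set p : G * G | adj p.1 p.2]].

(* A subgraph is given by its vertex set and its edge set. *)
Definition is_subgraph (H : {set G} * {set {set G}}) : bool :=
  (H.2 \subset edges) && (cover H.2 \subset H.1).

(* The averages are nonnegative, so the default value 0 of the iterated maximum
   matters only for the graph with no vertices, where it is the value of mad. *)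
Definition mad : rat :=
  (\big[Num.max/0]_(H : {set G} * {set {set G}}
                    | is_subgraph H && (H.1 != set0))
     (2%:R * #|H.2|%:R / #|H.1|%:R))%R.

Definition proper_coloring (C : choiceType) (phi : G -> C) : Prop :=
  forall v w, adj v w -> phi v <> phi w.

Definition dynamic_coloring (r : nat) (C : choiceType) (phi : G -> C) : Prop :=
  proper_coloring phi /\
  forall v, minn r (degree v) <= #|` [fset phi w | w in neighbors v]%fset |.

Definition dynamic_colorable (r : nat) (C : choiceType) (L : G -> {fset C}) :
    Prop :=
  exists phi : G -> C, dynamic_coloring r phi /\ forall v, phi v \in L v.

Definition dynamic_choosable (r k : nat) : Prop :=
  forall (C : choiceType) (L : G -> {fset C}),
    (forall v, k <= #|` L v|) -> dynamic_colorable r L.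

Lemma rainbow_from_lists (C : choiceType) (L : G -> {fset C}) (s : seq G) :
  (forall v, #|G| <= #|` L v|) -> uniq s ->
  exists phi : G -> C, (forall v, phi v \in L v) /\ {in s &, injective phi}.
Proof.
move=> hL; elim: s => [_|v s IHs /= /andP[vs us]].
  have /fin_all_exists[phi hphi] : forall v : G, exists c, c \in L v.
    move=> v; apply/fset0Pn; rewrite -cardfs_gt0.
    by apply: leq_trans (hL v); apply/card_gt0P; exists v.
  by exists phi.
have [phi [phiL phi_inj]] := IHs us.
have [c cL cs] : exists2 c, c \in L v & c \notin map phi s.
  apply/hasP; rewrite has_predC; apply/negP => /allP sub.
  have := uniq_leq_size (fset_uniq (L v)) sub; rewrite size_map leqNgt.
  move/negP; apply; apply: leq_trans (hL v).
  by rewrite -[_.+1]/(size (v :: s)) -(card_uniqP _) ?max_card //= vs.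
exists (fun w => if w == v then c else phi w); split=> [w|x y].
  by case: eqP => [->|].
rewrite !inE; case: (eqVneq x v) => [->|_] /=; case: (eqVneq y v) => [->|_] //=.
- by move=> _ ys cE; rewrite cE map_f in cs.
- by move=> xs _ cE; rewrite -cE map_f in cs.
- exact: phi_inj.
Qed.

Lemma dynamic_choosable_card (r : nat) : dynamic_choosable r #|G|.
Proof.
move=> C L hL.
have [phi [phiL phi_inj]] := rainbow_from_lists hL (enum_uniq G).
have inj : injective phi by move=> x y; apply: phi_inj; rewrite mem_enum.
exists phi; split=> //; split=> [v w vw /inj vwE|v].
  by rewrite vwE adj_irrefl in vw.
apply: leq_trans (geq_minr _ _) _; rewrite card_imfset //=.
by rewrite /degree cardE.
Qed.

Lemma ex_dynamic_choosable (r : nat) : exists k, `[< dynamic_choosable r k >].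
Proof. by exists #|G|; apply/asboolP/dynamic_choosable_card. Qed.

Definition list_dynamic_chromatic_number (r : nat) : nat :=
  ex_minn (ex_dynamic_choosable r).

End Graph.

(* Main.v *)
Require Import Defs.
From mathcomp Require Import all_boot all_order all_algebra.
From mathcomp Require Import finmap boolp zify.

(** Work in the subgraphs induced by vertex subsets [A], and let [A] be minimal
    such that the induced subgraph cannot be colored.  Call a vertex of degree 3
    with [k] neighbors of degree 2 a [k]-type vertex.  Give every vertex [v] the
    charge [7 deg v - 18].  A vertex of degree at least 3 sends 2 to each
    neighbor [c] of degree 2, except that a 3-type vertex sends only 1, and then
    the other neighbor of [c] sends 3.  Vertices of degree at least 4 and 0-type
    vertices send 1 to their neighbors of degree 3, and 1-type vertices send 1
    to their 2-type neighbors.  Minimality excludes the configurations in which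
    a vertex would end up with negative charge, so the average degree is at
    least 18/7.

    To exclude a configuration [S], color [A \ S].  Every remaining vertex [b]
    has a set [T b] of [min(3, deg b)] neighbors whose colors have to be
    distinct, so extending the coloring to [S] is a list coloring problem for a
    conflict graph on [S].  It is solved by the Combinatorial Nullstellensatz:
    some coefficient of the product of [x_u - x_v] over the conflicts [uv],
    with all exponents smaller than the list sizes, does not vanish.  Members of
    [S] with a common neighbor outside [S] may conflict in addition; all such
    coincidences are enumerated and checked by computation. *)

Set Implicit Arguments.
Unset Strict Implicit.
Unset Printing Implicit Defensive.
Import Order.TTheory GRing.Theory Num.Theory.

(** * Combinatorial Nullstellensatz for list coloring *)

(* The components count, with the two signs, the orientations of [E] in which
   [u] is the tail of [nth 0 k u - nth 0 m u] edges; their difference is thus a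
   coefficient of the product of the [x_u - x_v].  The last two tests only prune
   the search: they cut branches in which [u] or [v] has too few edges left. *)
Fixpoint orient_coef (k : seq nat) (E : seq (nat * nat)) (m : seq nat) :
    nat * nat :=
  if E is (u, v) :: E' then
    let branch x :=
      let m' := incr_nth m x in
      if [&& nth 0 m' x <= nth 0 k x,
             nth 0 k u <= nth 0 m' u + count (fun e => (e.1 == u) || (e.2 == u)) E'
           & nth 0 k v <= nth 0 m' v + count (fun e => (e.1 == v) || (e.2 == v)) E']
      then orient_coef k E' m' else (0, 0) in
    let p := branch u in let q := branch v in (p.1 + q.2, p.2 + q.1)
  else (1, 0).

Section Nullstellensatz.
Local Open Scope ring_scope.

(* The weights are those of the divided difference at the points of [s], built
   from [f |-> D_s ((f - f a) / (x - a))]. *)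
Lemma moment_weights (F : fieldType) (k : nat) (s : seq F) :
  uniq s -> size s = k.+1 ->
  exists w : F -> F, forall j, (j <= k)%N ->
    \sum_(b <- s) w b * b ^+ j = (j == k)%:R.
Proof.
elim: k s => [|k IHk] [|a s] //= /andP[as_ us] [sz].
  case: s sz {as_ us} => // _; exists (fun=> 1) => j; rewrite leqn0 => /eqP->.
  by rewrite big_seq1 expr0 mulr1.
have [w hw] := IHk s us sz.
pose w0 b := w b / (b - a).
(* The weight at [a] makes the total weight zero, so the functional depends only on the differences
   [f b - f a]. *)
exists (fun b => if b == a then - \sum_(c <- s) w0 c else w0 b) => j jk.
rewrite big_cons eqxx.
have -> : \sum_(b <- s) (if b == a then - \sum_(c <- s) w0 c else w0 b) * b ^+ j
        = \sum_(b <- s) w0 b * b ^+ j.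
  by apply: eq_big_seq => b bs; case: eqP => // ba; rewrite -ba bs in as_.
rewrite mulNr mulr_suml addrC -sumrB.
have -> : \sum_(b <- s) (w0 b * b ^+ j - w0 b * a ^+ j)
        = \sum_(i < j) a ^+ i * \sum_(b <- s) w b * b ^+ (j.-1 - i).
  under [RHS]eq_bigr do rewrite mulr_sumr.
  rewrite exchange_big /=; apply: eq_big_seq => b bs.
  rewrite -mulrBr subrXX /w0 mulrA divfK ?mulr_sumr; last first.
    by rewrite subr_eq0; apply: contra as_ => /eqP<-.
  by apply: eq_bigr => i _; rewrite -subn1 subnAC subn1 [RHS]mulrC mulrA.
(* Since [j] is at most [k.+1], only the term [i = 0] can contain the power of degree [k]. *)
case: j jk => [|j] jk; first by rewrite big_ord0.
rewrite big_ord_recl /= expr0 mul1r subn0 hw // big1 ?addr0 // => i _.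
rewrite hw; last by rewrite /bump /=; lia.
case: eqP => [|_]; last by rewrite mulr0.
by have := ltn_ord i; rewrite /bump /=; lia.
Qed.

Variables (n N : nat) (A : 'I_n.+1 -> {set 'I_N}) (k : seq nat).
Hypothesis size_k : size k = n.+1.
Hypothesis kA : forall i : 'I_n.+1, (nth 0%N k i < #|A i|)%N.

(** Colors are read as rational numbers, so that differences along edges can be multiplied. *)
Let val_of (f : {ffun 'I_n.+1 -> 'I_N}) (i : nat) : rat := (f (inord i))%:R.

Lemma ex_moment_weights : exists w : 'I_n.+1 -> 'I_N -> rat,
  forall (i : 'I_n.+1) j, (j <= nth 0%N k i)%N ->
    \sum_(c in A i) w i c * c%:R ^+ j = (j == nth 0%N k i)%:R.
Proof.
have := @fin_all_exists 'I_n.+1 (fun=> 'I_N -> rat)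
  (fun i w => forall j, (j <= nth 0%N k i)%N ->
    \sum_(c in A i) w c * c%:R ^+ j = (j == nth 0%N k i)%:R); apply => i.
pose s := [seq (c : 'I_N)%:R : rat | c : 'I_N <- take (nth 0%N k i).+1 (enum (A i))].
have us : uniq s.
  rewrite map_inj_uniq; first exact/take_uniq/enum_uniq.
  by move=> x y /eqP; rewrite eqr_nat => /eqP /val_inj.
have ss : size s = (nth 0%N k i).+1.
  by rewrite size_map size_takel // -cardE.
have [w hw] := moment_weights us ss.
exists (fun c => if c \in take (nth 0%N k i).+1 (enum (A i)) then w c%:R else 0).
move=> j jk; rewrite -(hw j jk) big_map -big_enum /=.
rewrite -[X in \big[_/_]_(c <- X) _](cat_take_drop (nth 0%N k i).+1) big_cat /=.
rewrite [X in _ + X]big_seq [X in _ + X]big1 ?addr0 => [|c cd].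
  by apply: eq_big_seq => c ->.
rewrite ifF ?mul0r //; apply: negbTE.
have := enum_uniq (A i); rewrite -{1}(cat_take_drop (nth 0%N k i).+1 (enum (A i))).
by rewrite cat_uniq => /and3P[_ /hasPn h _]; apply: h.
Qed.

(** The weighted sum of the edge product over all choices from the lists equals its coefficient at
    the exponents [k]. If this is nonzero, some choice has a nonzero product, hence distinct values
    at the ends of every edge. *)
Lemma orient_coef_colorable (E : seq (nat * nat)) :
  all (fun e => (e.1 < n.+1)%N && (e.2 < n.+1)%N) E ->
  sumn k = size E ->
  (let c := orient_coef k E (nseq n.+1 0%N) in c.1 != c.2) ->
  exists f : {ffun 'I_n.+1 -> 'I_N},
    (forall i, f i \in A i) /\
    all (fun e => f (inord e.1) != f (inord e.2)) E.
Proof.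
move=> En sumE; have [w hw] := ex_moment_weights.
(* The weighted sum of the monomial with exponents [m] times the product over [E]. If the total
   degree is [tot k], this is the coefficient at the exponents [k]. *)
pose F (E : seq (nat * nat)) (m : seq nat) : rat :=
  \sum_(f in family A) (\prod_i (w i (f i) * val_of f i ^+ nth 0%N m i))
     * \prod_(e <- E) (val_of f e.1 - val_of f e.2).
have Fnil m : F [::] m = \prod_i \sum_(c in A i) w i c * c%:R ^+ nth 0%N m i.
  rewrite bigA_distr_big_dep; apply: eq_bigr => f _.
  rewrite big_nil mulr1; apply: eq_bigr => i _.
  by rewrite /val_of inord_val.
have Fincr (f : {ffun 'I_n.+1 -> 'I_N}) (m : seq nat) u : (u < n.+1)%N ->
    \prod_i (w i (f i) * val_of f i ^+ nth 0%N (incr_nth m u) i)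
    = val_of f u * \prod_i (w i (f i) * val_of f i ^+ nth 0%N m i).
  move=> un; rewrite (bigD1 (Ordinal un)) //= [in RHS](bigD1 (Ordinal un)) //=.
  rewrite nth_incr_nth eqxx add1n exprS mulrCA -!mulrA; congr (_ * _).
  congr (_ * (_ * _)); apply: eq_bigr => i.
  rewrite nth_incr_nth eq_sym -(inj_eq val_inj) /= => /negbTE->.
  by rewrite add0n.
have Fcons u v E' m : (u < n.+1)%N -> (v < n.+1)%N ->
    F ((u, v) :: E') m = F E' (incr_nth m u) - F E' (incr_nth m v).
  move=> un vn; rewrite -sumrB; apply: eq_bigr => f _.
  by rewrite big_cons /= !Fincr // -!mulrA -mulrBl mulrCA.
pose tot (m : seq nat) := (\sum_(i < n.+1) nth 0%N m i)%N.
have tot_incr m u : (u < n.+1)%N -> tot (incr_nth m u) = (tot m).+1.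
  move=> un; rewrite /tot.
  under eq_bigr do rewrite nth_incr_nth.
  rewrite big_split /= (bigD1 (Ordinal un)) //= eqxx big1 // => i.
  by rewrite eq_sym -(inj_eq val_inj) /= => /negbTE->.
have tot_k : tot k = size E.
  by rewrite -sumE sumnE (big_nth 0%N) size_k big_mkord.
pose ends u (e : nat * nat) := (e.1 == u) || (e.2 == u).
(* The weights do not control powers above [k i]; but as the total degree is [tot k], an excess at
   [i] forces a deficit at some [j], where the moment is 0. *)
have F_over E' m (i : 'I_n.+1) :
    all (fun e => (e.1 < n.+1)%N && (e.2 < n.+1)%N) E' ->
    (tot m + size E' = tot k)%N -> (nth 0%N k i < nth 0%N m i)%N -> F E' m = 0.
  elim: E' m => [|[u v] E' IH] m /=.
    move=> _; rewrite addn0 => mk ki.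
    have [j jk] : exists j : 'I_n.+1, (nth 0%N m j < nth 0%N k j)%N.
      apply/existsP; apply: contraT => /existsPn h.
      suff : (tot k < tot m)%N by rewrite mk ltnn.
      rewrite /tot (bigD1 i) //= [X in (_ < X)%N](bigD1 i) //= -addSn.
      by apply: leq_add => //; apply: leq_sum => j _; rewrite leqNgt; apply: h.
    rewrite Fnil (bigD1 j) //= hw ?(ltnW jk) //.
    by rewrite (ltn_eqF jk) mul0r.
  move=> /andP[/andP[un vn] bE] mk ki.
  by rewrite Fcons // !IH ?subrr // ?tot_incr ?nth_incr_nth //; lia.
(* Even if every remaining edge at [i] contributed its factor there, the exponent would stay below
   [k i]. This justifies the pruning tests of [orient_coef]. *)
have F_under E' m (i : 'I_n.+1) :
    all (fun e => (e.1 < n.+1)%N && (e.2 < n.+1)%N) E' ->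
    (nth 0%N m i + count (ends i) E' < nth 0%N k i)%N -> F E' m = 0.
  elim: E' m => [|[u v] E' IH] m /=.
    rewrite addn0 => _ ki.
    by rewrite Fnil (bigD1 i) //= hw ?(ltnW ki) // (ltn_eqF ki) mul0r.
  move=> /andP[/andP[un vn] bE]; rewrite /ends /= => ki.
  rewrite Fcons // !IH ?subrr // nth_incr_nth; move: ki; rewrite /ends;
    by case: (u == i); case: (v == i) => /=; lia.
have F_main E' m : all (fun e => (e.1 < n.+1)%N && (e.2 < n.+1)%N) E' ->
    (tot m + size E' = tot k)%N -> 
    (forall i : 'I_n.+1, (nth 0%N m i <= nth 0%N k i)%N) ->
    F E' m = (orient_coef k E' m).1%:R - (orient_coef k E' m).2%:R.
  elim: E' m => [|[u v] E' IH] m.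
    move=> _ /=; rewrite addn0 => mk le_mk.
    rewrite subr0 Fnil big1 // => i _; rewrite hw //.
    suff -> : nth 0%N m i = nth 0%N k i :> nat by rewrite eqxx.
    apply/eqP; rewrite eqn_leq le_mk leqNgt; apply/negP => mi.
    suff : (tot m < tot k)%N by rewrite mk ltnn.
    rewrite /tot (bigD1 i) //= [X in (_ < X)%N](bigD1 i) //= -addSn.
    by apply: leq_add => //; apply: leq_sum.
  move=> /andP[/andP[/= un vn] bE] mk le_mk.
  have branchE x : (x < n.+1)%N ->
      let p := (let m' := incr_nth m x in
        if [&& nth 0%N m' x <= nth 0%N k x,
               nth 0%N k u <= nth 0%N m' u + count (ends u) E'
             & nth 0%N k v <= nth 0%N m' v + count (ends v) E']%N
        then orient_coef k E' m' else (0%N, 0%N)) in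
      F E' (incr_nth m x) = p.1%:R - p.2%:R.
    move=> xn /=.
    case: ifPn => [/and3P[mx _ _]|/nandP[|/nandP[]]].
    - apply: IH => // [|i]; first by rewrite tot_incr //; lia.
      rewrite nth_incr_nth; case: eqP => [xi|_]; last exact: le_mk.
      by rewrite xi nth_incr_nth eqxx in mx.
    - rewrite -ltnNge => mx; rewrite subrr.
      by apply: (F_over _ _ (Ordinal xn)) => //=; rewrite tot_incr //; lia.
    - by rewrite -ltnNge => mx; rewrite subrr (F_under _ _ (Ordinal un)).
    - by rewrite -ltnNge => mx; rewrite subrr (F_under _ _ (Ordinal vn)).
  by rewrite Fcons // !branchE //= !natrD opprB opprD addrACA.
move=> coefN0.
have F0 : F E (nseq n.+1 0%N) != 0.
  rewrite F_main // ?subr_eq0 ?eqr_nat //.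
    by rewrite /tot big1 ?add0n // => i _; rewrite nth_nseq if_same.
  by move=> i; rewrite nth_nseq if_same.
have [f fA fE] : exists2 f, f \in family A &
    all (fun e => val_of f e.1 != val_of f e.2) E.
  apply/exists_inP; apply: contraT => /exists_inPn noF.
  move: F0; rewrite /F big1 ?eqxx // => f /noF /allPn[e eE].
  rewrite negbK => /eqP fe.
  by rewrite (big_rem e) //= fe subrr mul0r mulr0.
exists f; split=> [i|]; first by move/familyP: fA; apply.
apply: sub_all fE => e; apply: contra => /eqP fe.
by rewrite /val_of fe.
Qed.

End Nullstellensatz.

(** * Configurations *)

(* A configuration is given by the adjacency lists [H] of its vertices
   [0, 1, ...] and the list [B] of those vertices that have one further neighbor
   outside the configuration.  The outer neighbors of the vertices in [light]
   keep three neighbors outside the configuration and therefore impose no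
   constraint except properness.  A labeling [l] of [B] records which vertices
   belong to the same trio of an outer neighbor. *)
Section Config.
Variables (H : seq (seq nat)) (B light : seq nat).

(** A vertex of the configuration has at most three neighbors, so all of them need distinct colors:
    a common neighbor inside always creates a conflict. *)
Definition base_conflict i j :=
  (j \in nth [::] H i) || has (fun p => j \in nth [::] H p) (nth [::] H i).

Definition same_label l i j :=
  [&& i \in B, j \in B & nth 0 l (index i B) == nth 0 l (index j B)].

Definition conflict_edges l : seq (nat * nat) :=
  [seq e <- [seq (i, j) | i <- iota 0 (size H), j <- iota 0 (size H)]
     | (e.1 < e.2) && (base_conflict e.1 e.2 || same_label l e.1 e.2)].

Definition extra_conflict l i j :=
  [&& i != j, same_label l i j & ~~ base_conflict i j].

(** Each extra conflict at [j] places another member of its trio inside the configuration, so the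
    outside forbids one color fewer. This count is the compensation. *)
Definition extra_degree l j := count (extra_conflict l ^~ j) (iota 0 (size H)).

(* A bound on the number of colors that the outside forbids at [j], before
   counting the members of its trio that lie in the configuration. *)
Definition outer_bound j :=
  count (mem B) (nth [::] H j)
  + (if j \in B then if j \in light then 1 else 3 else 0).

(* [k0] is an exponent vector for the conflicts present in every labeling; an
   extra conflict raises the exponent of its larger end. *)
Definition good_target l k0 :=
  let k := mkseq (fun j => nth 0 k0 j
             + count (fun i => (i < j) && extra_conflict l i j) (iota 0 (size H)))
             (size H) in
  let E := conflict_edges l in
  [&& all (fun j => nth 0 k j + outer_bound j < 6 + extra_degree l j)
          (iota 0 (size H)),
      sumn k == size E
    & let c := orient_coef k E (nseq (size H) 0) in c.1 != c.2].

(** A class is labeled by its first position, so the label at position [i] may be restricted to at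
    most [i]. *)
Fixpoint labelings m : seq (seq nat) :=
  if m is m'.+1
  then [seq rcons l i | l <- labelings m', i <- iota 0 m'.+1] else [:: [::]].

(* The label of a class is the position of its first member. *)
Definition trio_labeling l :=
  all (fun i => (nth 0 l (nth 0 l i) == nth 0 l i) && (count_mem i l <= 3))
      (iota 0 (size l)).

Definition check_config ks :=
  all (fun l => trio_labeling l ==> has (good_target l) ks)
      (labelings (size B)).

Lemma mem_labelings m l :
  size l = m -> (forall i, i < m -> nth 0 l i <= i) -> l \in labelings m.
Proof.
elim: m l => [|m IHm] l; first by move/size0nil->.
case/lastP: l => // l x; rewrite size_rcons => -[sz] h.
apply/allpairsP; exists (l, x); split=> //=.
  apply: IHm => // i im; have := h i (ltnW im).
  by rewrite nth_rcons sz im.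
have := h m (leqnn _); rewrite nth_rcons sz ltnn eqxx => xm.
by rewrite -[0 :: _]/(iota 0 m.+1) mem_iota /= add0n ltnS.
Qed.

(** Colors are replaced by their positions in the union [U] of the lists; the first test of
    [good_target] then bounds the exponents by the list sizes. *)
Lemma good_target_coloring (C : choiceType) (LS : nat -> {fset C}) l k0 :
  0 < size H -> good_target l k0 ->
  (forall j, j < size H ->
     6 + extra_degree l j <= #|` LS j| + outer_bound j) ->
  exists f : nat -> C, (forall j, j < size H -> f j \in LS j) /\
    (forall i j, i < j -> j < size H ->
       base_conflict i j || same_label l i j -> f i <> f j).
Proof.
case nE: (size H) => [//|n] _ /and3P[] + /eqP + coefN0 hLS.
move: coefN0; rewrite nE.
set k := mkseq _ _; set E := conflict_edges l => coefN0 /allP kb sumk.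
pose U := undup (flatten [seq enum_fset (LS j) | j <- iota 0 n.+1]).
pose N := size U.
have US j c : j < n.+1 -> c \in LS j -> c \in U.
  move=> jn cj; rewrite mem_undup; apply/flatten_mapP; exists j => //.
  by rewrite mem_iota.
(* [nth] needs a default color; one exists because the bounds make the list of vertex 0 nonempty. *)
have [U0|[c0 c0U]] : U = [::] \/ exists c0, c0 \in U.
  by case: (U) => [|c ?]; [left|right; exists c; rewrite inE eqxx].
  have := hLS 0 isT; suff -> : LS 0 = fset0.
    rewrite cardfs0 => h; have := kb 0; rewrite mem_iota => /(_ isT).
    by move: h; rewrite add0n => h1 h2; have := leq_trans h2 h1; lia.
  apply/fsetP => c; rewrite inE; apply/negP => /(US 0 c isT).
  by rewrite U0.
pose A (i : 'I_n.+1) : {set 'I_N} := [set c : 'I_N | nth c0 U c \in LS i].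
have cardA (i : 'I_n.+1) : #|` LS i| <= #|A i|.
  rewrite -(size_image (fun c : 'I_N => nth c0 U c) (A i)).
  apply: uniq_leq_size (fset_uniq _) _ => c cS.
  have cU : index c U < N by rewrite index_mem (US i).
  apply/imageP; exists (Ordinal cU); rewrite ?inE /= nth_index ?(US i) //.
have kA (i : 'I_n.+1) : nth 0 k i < #|A i|.
  have := hLS i (ltn_ord i); have := cardA i.
  by have := kb i; rewrite mem_iota ltn_ord => /(_ isT); lia.
have En : all (fun e => (e.1 < n.+1) && (e.2 < n.+1)) E.
  apply/allP => e; rewrite mem_filter => /andP[_].
  rewrite nE => /allpairsP[[i j] []]; rewrite !mem_iota => /= iN jN ->.
  by rewrite /= iN jN.
have [f [fA fE]] := orient_coef_colorable (size_mkseq _ _) kA En sumk coefN0.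
exists (fun j => nth c0 U (f (inord j))); split=> [j jn|i j ij jn cij].
  by have := fA (inord j); rewrite inE inordK.
move/eqP; rewrite nth_uniq ?undup_uniq ?ltn_ord //.
have /(allP fE) /= : (i, j) \in E.
  rewrite mem_filter /= ij cij /= nE; apply/allpairsP.
  by exists (i, j); rewrite !mem_iota /= add0n jn (ltn_trans ij jn).
by rewrite -(inj_eq val_inj) => /negbTE->.
Qed.

End Config.

(** * Extending a coloring *)

Lemma exists_set_between (T : finType) (X Y : {set T}) k :
  X \subset Y -> #|X| <= k <= #|Y| ->
  exists Z : {set T}, [/\ X \subset Z, Z \subset Y & #|Z| = k].
Proof.
move=> XY; elim: k => [|k IHk] /andP[Xk kY].
  by exists X; split=> //; apply/eqP; rewrite -leqn0.
move: Xk; rewrite leq_eqVlt => /predU1P[Xk|]; first by exists X.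
rewrite ltnS => Xk; have [|Z [XZ ZY cZ]] := IHk; first by rewrite Xk ltnW.
have /subsetPn[y yY yZ] : ~~ (Y \subset Z).
  by apply: contraL kY => /subset_leq_card; rewrite cZ -leqNgt.
exists (y |: Z); split; last by rewrite cardsU1 yZ cZ.
  by rewrite subsetU // XZ orbT.
by apply/subsetP => z; rewrite !inE => /predU1P[->|/(subsetP ZY)].
Qed.

Section Rainbow.
Variables (V : finType) (C : choiceType) (phi : V -> C).

Lemma card_colors_inj (X : {set V}) :
  {in X &, injective phi} -> #|` [fset phi w | w in X]%fset| = #|X|.
Proof. by move=> inj; rewrite card_in_imfset //= -cardE. Qed.

Lemma leq_card_colors (X : {set V}) : #|` [fset phi w | w in X]%fset| <= #|X|.
Proof. by rewrite (leq_trans (leq_imfset_card _ _ _)) //= cardE. Qed.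

Lemma ex_rainbow_subset (X : {set V}) k :
  k <= #|` [fset phi w | w in X]%fset| ->
  exists T : {set V}, [/\ T \subset X, #|T| = k & {in T &, injective phi}].
Proof.
elim: k => [|k IHk] kX.
  by exists set0; rewrite sub0set cards0; split=> // x; rewrite inE.
have [T [TX cT injT]] := IHk (ltnW kX).
have /fsubsetPn[c /imfsetP[/= w wX ->] wT] :
    ~~ ([fset phi w | w in X] `<=` [fset phi w | w in T])%fset.
  apply: contraL kX => /fsubset_leq_card; rewrite -leqNgt => h.
  by rewrite (leq_trans h) // -cT leq_card_colors.
have phiw x : x \in T -> phi x <> phi w.
  by move=> xT xw; case/negP: wT; apply/imfsetP; exists x.
exists (w |: T); split.
- by apply/subsetP => z; rewrite !inE => /predU1P[->|/(subsetP TX)].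
- by rewrite cardsU1 cT; case: (boolP (w \in T)) => // /phiw.
move=> x y; rewrite !inE => /predU1P[->|xT] /predU1P[->|yT] // e.
- by case: (phiw y yT).
- by case: (phiw x xT).
- exact: injT.
Qed.

End Rainbow.

Section Coloring.
Variables (G : sgraph) (C : choiceType) (L : G -> {fset C}).
Implicit Types (A S : {set G}) (phi psi : G -> C).

Definition nb A v : {set G} := [set w in A | adj v w].

Definition dyn_on A phi :=
  [/\ forall v, v \in A -> phi v \in L v,
      forall v w, v \in A -> w \in A -> adj v w -> phi v <> phi w
    & forall v, v \in A ->
        minn 3 #|nb A v| <= #|` [fset phi w | w in nb A v]%fset|].

Definition colorable_on A := exists phi, dyn_on A phi.

(** Fixing which neighbors of [v] must differ turns the dynamic condition into conflicts between
    pairs. The last clause keeps [S] out of the constraint at [v] whenever three neighbors remain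
    outside [S]. *)
Definition trio_system A S phi (T : G -> {set G}) :=
  forall v, v \in A ->
    [/\ T v \subset nb A v, #|T v| = minn 3 #|nb A v|,
        {in T v :\: S &, injective phi}
      & 3 <= #|nb A v :\: S| -> [disjoint T v & S]].

Lemma nb_setD A S v : nb (A :\: S) v = nb A v :\: S.
Proof. by apply/setP => w; rewrite !inE andbA. Qed.

(** A vertex of [S] takes all its neighbors. Any other vertex takes a rainbow triple outside [S] if
    it has three neighbors there; otherwise its neighbors outside [S] are already rainbow and are
    padded with members of [S]. *)
Lemma ex_trio_system A S phi :
  S \subset A -> dyn_on (A :\: S) phi ->
  (forall u, u \in S -> #|nb A u| <= 3 /\ {in nb A u :\: S &, injective phi}) ->
  exists T, trio_system A S phi T.
Proof.
move=> SA [_ _ dynS] hS.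
have := @fin_all_exists G (fun=> {set G}) (fun v Tv => v \in A ->
    [/\ Tv \subset nb A v, #|Tv| = minn 3 #|nb A v|,
        {in Tv :\: S &, injective phi}
      & 3 <= #|nb A v :\: S| -> [disjoint Tv & S]]).
apply=> v.
have [vA|vA] := boolP (v \in A); last by exists set0.
have [vS|vS] := boolP (v \in S).
  have [d3 inj] := hS v vS; exists (nb A v) => _; split=> //.
    by apply/esym/minn_idPr.
  move=> h; suff -> : nb A v = nb A v :\: S.
    by rewrite disjoint_sym -setI_eq0 setIDA setDIl setDv set0I.
  apply/esym/eqP; rewrite eqEcard subsetDl.
  exact: leq_trans d3 h.
have := dynS v; rewrite inE vS vA nb_setD => /(_ isT) dynv.
have nbS : #|nb A v :\: S| <= #|nb A v| by rewrite subset_leq_card ?subsetDl.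
have [d3|d3] := leqP 3 #|nb A v :\: S|.
  have [|T [TX cT injT]] := @ex_rainbow_subset _ _ phi (nb A v :\: S) 3.
    by rewrite (leq_trans _ dynv) // leq_min leqnn d3.
  exists T => _; split.
  - exact: subset_trans TX (subsetDl _ _).
  - by rewrite cT; apply/esym/minn_idPl; apply: leq_trans nbS.
  - by apply: sub_in2 injT => x /setDP[].
  by move=> _; move: TX; rewrite subsetD => /andP[].
have injX : {in nb A v :\: S &, injective phi}.
  have [|T [TX cT injT]] :=
      @ex_rainbow_subset _ _ phi (nb A v :\: S) #|nb A v :\: S|.
    by rewrite (leq_trans _ dynv) // leq_min leqnn ltnW.
  suff <- : T = nb A v :\: S by [].
  by apply/eqP; rewrite eqEcard TX cT leqnn.
have [||T [XT TX cT]] :=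
    @exists_set_between _ (nb A v :\: S) (nb A v) (minn 3 #|nb A v|).
- exact: subsetDl.
- by rewrite leq_min nbS ltnW //= geq_minr.
exists T => _; split=> //.
apply: sub_in2 injX => x /setDP[xT xS].
by rewrite inE xS (subsetP TX).
Qed.

Lemma dyn_on_trios A psi (T : G -> {set G}) :
  (forall v, v \in A -> psi v \in L v) ->
  (forall v w, v \in A -> w \in A -> adj v w -> psi v <> psi w) ->
  (forall v, v \in A -> [/\ T v \subset nb A v, #|T v| = minn 3 #|nb A v|
     & {in T v &, injective psi}]) ->
  dyn_on A psi.
Proof.
move=> psiL psiP hT; split=> // v /hT[TX <- inj].
rewrite -(card_colors_inj inj); apply: fsubset_leq_card.
by apply/fsubsetP => c /imfsetP[w /= wT ->]; rewrite in_imfset //= (subsetP TX).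
Qed.

Hypothesis L6 : forall v, 6 <= #|` L v|.

(* Either alternative forces [x] and [y] to have distinct colors in [A :\ a] and
   leaves at most 5 forbidden colors for [a]. *)
Lemma two_vertex_reducible A a x y :
  a \in A -> nb A a =i [:: x; y] -> x != y ->
  (adj x y \/ exists2 z, z \in A & [/\ z != a, adj z x, adj z y & #|nb A z| <= 3]) ->
  colorable_on (A :\ a) -> colorable_on A.
Proof.
move=> aA nba xy hxy [phi dphi].
have adjC (u v : G) : adj u v = adj v u by apply: adj_sym.
have [xA ax] : x \in A /\ adj a x.
  by have := nba x; rewrite !inE eqxx => /andP[].
have [yA ay] : y \in A /\ adj a y.
  by have := nba y; rewrite !inE eqxx orbT => /andP[].
have xa : x != a by apply: contraTneq ax => ->; rewrite adj_irrefl.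
have ya : y != a by apply: contraTneq ay => ->; rewrite adj_irrefl.
have phixy : phi x <> phi y.
  case: dphi => _ pphi dyn; case: hxy => [|[z zA [za zx zy z3]]].
    by apply: pphi; rewrite !inE ?xa ?ya.
  have := dyn z; rewrite !inE za zA nb_setD => /(_ isT) dz.
  have [|T [TX cT injT]] :=
      @ex_rainbow_subset _ _ phi (nb A z :\ a) #|nb A z :\ a|.
    rewrite (leq_trans _ dz) // leq_min leqnn andbT.
    by apply: leq_trans z3; rewrite subset_leq_card ?subsetDl.
  have TE : T = nb A z :\ a by apply/eqP; rewrite eqEcard TX cT leqnn.
  move=> e; move: xy; rewrite (injT x y) ?eqxx // TE !inE ?xa ?ya ?xA ?yA //.
have nba2 : nb A a = [set x; y].
  by apply/setP => w; rewrite nba !inE.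
have aS : [set a] \subset A by rewrite sub1set.
have hS u : u \in [set a] ->
    #|nb A u| <= 3 /\ {in nb A u :\: [set a] &, injective phi}.
  rewrite inE => /eqP ->; rewrite nba2 cards2; split; first by case: (x != y).
  move=> u1 u2; rewrite !inE => /andP[_ /orP[]/eqP->] /andP[_ /orP[]/eqP->] //.
  by move=> e; case: phixy.
have [T hT] := ex_trio_system aS dphi hS.
pose forb v := if a \in T v then T v :\ a else set0.
(* If the trio of [v] contains [a], then [v] has at most two other neighbors, since otherwise the
   trio would avoid [a]. *)
have hforb v : v \in A -> adj v a -> forb v = set0 \/
    #|nb A v :\ a| <= 2 /\ forb v = nb A v :\ a.
  move=> vA va; rewrite /forb; case: ifP => aT; last by left.
  have [TX cT _ dT] := hT v vA; right.
  have d2 : #|nb A v :\ a| <= 2.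
    rewrite leqNgt; apply/negP => /dT; rewrite disjoint_sym disjoints1.
    by rewrite aT.
  split=> //; congr (_ :\ _); apply/eqP; rewrite eqEcard TX cT.
  rewrite leq_min leqnn andbT (cardsD1 a (nb A v)) inE aA va.
  by rewrite add1n ltnS.
(* The vertices whose colors [a] must avoid. The crude bound is 2 + 2 + 2, one too many for lists of
   size 6. *)
pose O := [set x; y] :|: (forb x :|: forb y).
have O5 : #|O| <= 5.
  have xya : adj x a by rewrite adjC.
  have yya : adj y a by rewrite adjC.
  have cU (X Y : {set G}) : #|X :|: Y| <= #|X| + #|Y|.
    by rewrite cardsU leq_subr.
  have c2 : #|[set x; y]| <= 2 by rewrite cards2; case: (x != y).
  have [fx|[dx fx]] := hforb x xA xya; have [fy|[dy fy]] := hforb y yA yya.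
  - by rewrite /O fx fy !setU0 (leq_trans c2).
  - rewrite /O fx fy set0U (leq_trans (cU _ _)) //.
    by rewrite (leq_trans (leq_add c2 dy)).
  - rewrite /O fx fy setU0 (leq_trans (cU _ _)) //.
    by rewrite (leq_trans (leq_add c2 dx)).
  (* If [x] and [y] are adjacent, each is already counted as a neighbor of the other; otherwise [z]
     is counted twice. *)
  case: hxy => [xyadj|[z zA [za zx zy z3]]].
    have -> : O = (nb A x :\ a) :|: (nb A y :\ a).
      rewrite /O fx fy; apply/setUidPr/subsetP => w; rewrite !inE => /orP[]/eqP->.
        by rewrite xa xA (adjC y x) xyadj orbT.
      by rewrite ya yA xyadj.
    by rewrite (leq_trans (cU _ _)) // (leq_trans (leq_add dx dy)).
  have zI : z \in (nb A x :\ a) :&: (nb A y :\ a).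
    by rewrite !inE za zA !(adjC _ z) zx zy.
  have i0 : 0 < #|(nb A x :\ a) :&: (nb A y :\ a)| by apply/card_gt0P; exists z.
  rewrite /O fx fy (leq_trans (cU _ _)) // (leq_trans (leq_add c2 (leqnn _))) //.
  rewrite add2n !ltnS -(leq_add2r 1) (leq_trans (leq_add (leqnn _) i0)) //.
  by rewrite cardsUI (leq_trans (leq_add dx dy)).
have [c cL cO] : exists2 c, c \in L a & c \notin [fset phi w | w in O]%fset.
  apply/fsubsetPn/negP => /fsubset_leq_card h.
  have := leq_trans (L6 a) (leq_trans h (leq_card_colors phi O)).
  by rewrite leqNgt ltnS O5.
have phiO w : w \in O -> phi w <> c.
  by move=> wO e; case/negP: cO; rewrite -e in_imfset.
pose psi v := if v == a then c else phi v.
have adj_a v : v \in A -> adj v a -> v \in O /\ forb v \subset O.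
  move=> vA va; have : v \in nb A a by rewrite inE vA adjC.
  rewrite nba2 !inE => /orP[]/eqP->; rewrite eqxx ?orbT; split=> //.
    by apply/subsetP => w wf; rewrite !inE wf !orbT.
  by apply/subsetP => w wf; rewrite !inE wf !orbT.
have [phiL phiP _] := dphi.
exists psi; apply: (@dyn_on_trios _ _ T) => [v vA|v w vA wA vw|v vA].
- by rewrite /psi; case: eqP => [->//|/eqP va]; apply: phiL; rewrite !inE va.
- rewrite /psi; case: eqP => [va|/eqP va]; case: eqP => [wa|/eqP wa].
  + by move: vw; rewrite va wa adj_irrefl.
  + move/esym; apply: phiO; apply: (adj_a w wA _).1.
    by rewrite adjC -va.
  + by apply: phiO; apply: (adj_a v vA _).1; rewrite -wa.
  + by apply: phiP => //; rewrite !inE ?va ?wa ?vA ?wA.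
have [TX cT injT _] := hT v vA; split=> // u1 u2 u1T u2T.
have va u : a \in T v -> u \in T v -> u != a -> phi u <> c.
  move=> aT uT ua; apply: phiO.
  have /(subsetP TX) : a \in T v by []; rewrite inE => /andP[_ av].
  apply: (subsetP (adj_a v vA av).2); rewrite /forb aT !inE ua.
  by rewrite uT.
rewrite /psi; case: eqP => [e1|/eqP e1]; case: eqP => [e2|/eqP e2].
- by rewrite e1 e2.
- have aT : a \in T v by rewrite -e1.
  by move/esym/(va u2 aT u2T e2).
- have aT : a \in T v by rewrite -e2.
  by move/(va u1 aT u1T e1).
- by apply: injT; rewrite !inE ?e1 ?e2.
Qed.

End Coloring.

(** * Reducible configurations *)

Definition wf_config (H : seq (seq nat)) (B : seq nat) :=
  [&& 0 < size H, uniq B, all (fun i => i < size H) B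
    & all (fun i => (size (nth [::] H i) + (i \in B) <= 3)
             && all (fun j => (j < size H) && (i \in nth [::] H j))
                    (nth [::] H i))
          (iota 0 (size H))].

Section ConfigReducible.
Variables (G : sgraph) (C : choiceType) (L : G -> {fset C}).
Hypothesis L6 : forall v, 6 <= #|` L v|.
Variables (H : seq (seq nat)) (B light : seq nat) (ks : seq (seq nat)).
Variables (A : {set G}) (x0 : G) (s os : seq G).

Let p i := nth x0 s i.
Let o i := nth x0 os i.
Let S : {set G} := [set x in s].

Definition nbseq i :=
  [seq nth x0 s j | j <- nth [::] H i]
  ++ (if i \in B then [:: nth x0 os i] else [::]).

(** Here [s] realizes the configuration in [G], and [os] lists the outer neighbors. Since [nbseq]
    reads [os] only at positions in [B], the other positions hold fillers in the applications. The
    trios of the outer neighbors determine a labeling, for which the check supplies a suitable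
    exponent vector. *)
Lemma config_reducible :
  wf_config H B -> check_config H B light ks ->
  size s = size H -> uniq s -> {subset s <= A} ->
  (forall i, i < size H -> nb A (nth x0 s i) =i nbseq i /\ uniq (nbseq i)) ->
  (forall i j, i \in B -> j \in B -> nth x0 os i != nth x0 s j) ->
  (forall i, i \in light -> 3 <= #|nb A (nth x0 os i) :\: [set x in s]|) ->
  colorable_on L (A :\: [set x in s]) -> colorable_on L A.
Proof.
move=> /and4P[H0 uB /allP Bn /allP wfH] chk sz us sA hnb oB hlight [phi dphi].
have adjC (u v : G) : adj u v = adj v u by apply: adj_sym.
have szH i : i < size H -> size (nth [::] H i) + (i \in B) <= 3.
  by move=> iH; have := wfH i; rewrite mem_iota iH => /(_ isT)/andP[].
have Hlt i j : i < size H -> j \in nth [::] H i -> j < size H.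
  move=> iH jH; have := wfH i; rewrite mem_iota iH => /(_ isT)/andP[_ /allP].
  by move/(_ j jH) => /andP[].
have Hsym i j : i < size H -> j \in nth [::] H i -> i \in nth [::] H j.
  move=> iH jH; have := wfH i; rewrite mem_iota iH => /(_ isT)/andP[_ /allP].
  by move/(_ j jH) => /andP[].
have ps i : i < size H -> p i \in s by move=> iH; rewrite mem_nth ?sz.
have pS i : i < size H -> p i \in S by move=> iH; rewrite inE ps.
have pA i : i < size H -> p i \in A by move=> iH; apply/sA/ps.
have p_inj i j : i < size H -> j < size H -> p i = p j -> i = j.
  by move=> iH jH /eqP; rewrite nth_uniq ?sz // => /eqP.
have Sp x : x \in S -> exists2 i, i < size H & x = p i.
  by rewrite inE => /(nthP x0)[i]; rewrite sz => iH <-; exists i.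
have nbP i x : i < size H -> (x \in nb A (p i)) =
    (x \in [seq p j | j <- nth [::] H i]) || (i \in B) && (x == o i).
  move=> iH; rewrite (hnb i iH).1 mem_cat; congr (_ || _).
  by case: ifP; rewrite ?inE.
have oNb i : i \in B -> o i \in nb A (p i).
  by move=> iB; rewrite nbP ?Bn // iB eqxx orbT.
have oA i : i \in B -> o i \in A by move/oNb; rewrite inE => /andP[].
have oadj i : i \in B -> adj (o i) (p i).
  by move/oNb; rewrite inE adjC => /andP[].
(* If [o i] were [p j], the edge would be an inner one, and the neighbor list of [p i] would have a
   repetition, or it would be the outer edge of [p j], which [oB] excludes. *)
have oNs i : i \in B -> o i \notin S.
  move=> iB; apply/negP => /Sp[j jH oj].
  have : p i \in nb A (p j) by rewrite inE pA ?Bn // -oj oadj.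
  rewrite nbP // => /orP[/mapP[q qH /(p_inj _ _ (Bn i iB) (Hlt j q jH qH)) iq]|].
    have := (hnb i (Bn i iB)).2; rewrite /nbseq iB cat_uniq /= orbF.
    rewrite -/(o i) oj => /and3P[_ /negP[]]; apply: map_f.
    by rewrite iq; apply: Hsym.
  by case/andP => jB; rewrite eq_sym (negbTE (oB j i jB iB)).
have nbD i x : i < size H -> x \in nb A (p i) -> x \notin S -> i \in B /\ x = o i.
  move=> iH; rewrite nbP // => /orP[/mapP[j jH ->]|/andP[iB /eqP->]] //.
  by rewrite pS // (Hlt i).
have SA : S \subset A by apply/subsetP => x; rewrite inE; apply: sA.
have hS u : u \in S -> #|nb A u| <= 3 /\ {in nb A u :\: S &, injective phi}.
  move=> /Sp[i iH ->]; split.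
    have -> : #|nb A (p i)| = size (nbseq i).
      rewrite -(card_uniqP (hnb i iH).2); apply: eq_card; exact: (hnb i iH).1.
    rewrite size_cat size_map; apply: leq_trans (szH i iH).
    by case: (i \in B).
  by move=> x y /setDP[/(nbD i _ iH) hx /hx[_ ->]] /setDP[/(nbD i _ iH) hy /hy[_ ->]].
have [T hT] := ex_trio_system SA dphi hS.
pose trio i := p i \in T (o i).
(* The classes are the parts of trios inside [S]; a vertex missing from the trio of its outer
   neighbor forms a class of its own. *)
pose R i j := (i == j) || [&& o i == o j, trio i & trio j].
have Rsym i j : R i j = R j i.
  by rewrite /R eq_sym [o j == _]eq_sym [trio j && _]andbC.
have Rtrans i j k : R i j -> R j k -> R i k.
  rewrite /R => /predU1P[->//|/and3P[/eqP oij ti tj]].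
  move=> /predU1P[<-|/and3P[/eqP ojk _ tk]]; apply/orP; right.
    by rewrite oij eqxx ti tj.
  by rewrite oij ojk eqxx ti tk.
have Req i j : R i j -> R i =1 R j.
  move=> Rij k; apply/idP/idP; last exact: Rtrans.
  by apply: Rtrans; rewrite Rsym.
have Rrefl i : R i i by rewrite /R eqxx.
pose l := [seq find (R i) B | i <- B].
have szl : size l = size B by rewrite size_map.
have hasR i : i \in B -> has (R i) B by move=> iB; apply/hasP; exists i.
have Rfind i : i \in B -> R i (nth 0 B (find (R i) B)).
  by move=> iB; apply: nth_find; apply: hasR.
have findB i : i \in B -> nth 0 B (find (R i) B) \in B.
  by move=> iB; rewrite mem_nth // -has_find hasR.
have lE i : i \in B -> nth 0 l (index i B) = find (R i) B.
  by move=> iB; rewrite (nth_map 0) ?index_mem // nth_index.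
have same_labelP i j : same_label B l i j -> [/\ i \in B, j \in B & R i j].
  case/and3P=> iB jB; rewrite !lE // => /eqP ij; split=> //.
  apply: (Rtrans _ _ _ (Rfind i iB)); rewrite ij Rsym; exact: Rfind.
have R_same_label i j : i \in B -> j \in B -> R i j -> same_label B l i j.
  move=> iB jB Rij; rewrite /same_label iB jB !lE //=.
  by rewrite (eq_find (Req i j Rij)).
have RT i j : i \in B -> j \in B -> R i j -> i != j ->
    trio j /\ p i \in T (o j).
  move=> iB jB + /negbTE ij; rewrite /R ij /= => /and3P[/eqP oij ti tj].
  by split=> //; rewrite -oij.
have T3 j : j \in B -> #|T (o j)| <= 3.
  by move=> jB; have [_ -> _ _] := hT _ (oA j jB); rewrite geq_minl.
have lab : l \in labelings (size B).
  apply: mem_labelings => // i iB; rewrite (nth_map 0) // leqNgt.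
  by apply/negP => /(before_find 0); rewrite Rrefl.
have trl : trio_labeling l.
  apply/allP => i; rewrite mem_iota szl /= add0n => iB.
  have biB := mem_nth 0 iB.
  apply/andP; split.
    rewrite (nth_map 0 0 _ iB); set b := nth 0 B i.
    have /eqP := lE _ (findB b biB); rewrite index_uniq //; last first.
      by rewrite -has_find hasR.
    by move/eqP->; rewrite -(eq_find (Req _ _ (Rfind b biB))).
  rewrite count_map; set P := preim _ _.
  have PR j : j \in filter P B -> j \in B /\ R j (nth 0 B i).
    rewrite mem_filter /= => /andP[/eqP ij jB]; split=> //.
    by rewrite -ij Rfind.
  (* As soon as a class has two members, all of it lies in a single trio, hence has at most three
     members. *)
  rewrite -size_filter; case E: (filter P B) => [|j1 [|j2 r]] //.
  rewrite -E; have [tb sub] : trio (nth 0 B i) /\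
      {subset [seq p j | j <- filter P B] <= T (o (nth 0 B i))}.
    set b := nth 0 B i.
    have [j jP jb] : exists2 j, j \in filter P B & j != b.
      have : uniq (filter P B) by rewrite filter_uniq.
      rewrite E /= inE => /andP[/norP[j12 _] _].
      case: (eqVneq j1 b) => [jb|jb]; last by exists j1; rewrite // inE eqxx.
      by exists j2; rewrite ?inE ?eqxx ?orbT // -jb eq_sym.
    have [jB Rjb] := PR j jP; have [tb _] := RT j b jB biB Rjb jb.
    split=> // x /mapP[q /PR[qB Rqb] ->].
    have [->//|qb] := eqVneq q b.
    by have [] := RT q b qB biB Rqb qb.
  rewrite -(size_map p) (leq_trans _ (T3 _ biB)) // cardE.
  apply: uniq_leq_size => [|x /sub]; last by rewrite mem_enum.
  rewrite map_inj_in_uniq ?filter_uniq // => j k /PR[jB _] /PR[kB _].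
  by apply: p_inj; apply: Bn.
have /hasP[k0 _ gt] : has (good_target H B light l) ks.
  by move/allP: chk => /(_ l lab); rewrite trl.
(* The three sources of forbidden colors: outer neighbors of inner neighbors, the own outer
   neighbor, and the outside part of its trio. *)
pose Out j : {set G} := [set x in [seq o q | q <- nth [::] H j & q \in B]]
  :|: (if j \in B then
         o j |: (if trio j then T (o j) :\: S else set0) else set0).
pose LS j := (L (p j) `\` [fset phi x | x in Out j])%fset.
have cU (X Y : {set G}) : #|X :|: Y| <= #|X| + #|Y|.
  by rewrite cardsU leq_subr.
have hLS j : j < size H ->
    6 + extra_degree H B l j <= #|` LS j| + outer_bound H B light j.
  move=> jH.
  have : #|Out j| + extra_degree H B l j <= outer_bound H B light j.
    have c1 : #|[set x in [seq o q | q <- nth [::] H j & q \in B]]|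
              <= count (mem B) (nth [::] H j).
      rewrite cardsE (leq_trans (card_size _)) // size_map size_filter.
      by apply: eq_leq; apply: eq_count.
    apply: (@leq_trans (count (mem B) (nth [::] H j) + #|if j \in B then
         o j |: (if trio j then T (o j) :\: S else set0) else set0|
         + extra_degree H B l j)).
      by rewrite leq_add2r; apply: leq_trans (cU _ _) _; rewrite leq_add2r.
    rewrite -addnA leq_add2l.
    have extra0 : ~~ ((j \in B) && trio j) -> extra_degree H B l j = 0.
      move=> nj; apply/eqP; rewrite -leqn0 leqNgt -has_count; apply/hasP.
      case=> i _ /and3P[ij /same_labelP[iB jB Rij] _].
      by case/negP: nj; rewrite jB; case: (RT i j iB jB Rij ij).
    case: ifP => jB; last first.
      by rewrite cards0 add0n extra0 // jB.
    case: ifP => tj; last first.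
      rewrite extra0; last by apply/nandP; right; apply: negbT.
      by rewrite setU0 cards1; case: ifP.
    (* The trio at the outer neighbor of a light vertex avoids [S], so it cannot contain [p j]. *)
    rewrite ifF; last first.
      apply/negP => /hlight h; have [_ _ _ /(_ h)] := hT _ (oA j jB).
      rewrite disjoints_subset => /subsetP/(_ _ tj).
      by rewrite inE pS ?Bn.
    (* Besides [p j], the trio has at most two members. Those outside are in [Out j], and those
       inside bound [extra_degree]; with [o j] this gives the 3 of [outer_bound]. *)
    have c2 : #|o j |: (T (o j) :\: S)| <= 1 + #|T (o j) :\: S|.
      by rewrite (leq_trans (cU _ _)) // cards1.
    have c3 : extra_degree H B l j <= #|(T (o j) :&: S) :\ p j|.
      rewrite /extra_degree -size_filter -(size_map p) cardE.
      apply: uniq_leq_size.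
        rewrite map_inj_in_uniq ?filter_uniq ?iota_uniq // => i k.
        rewrite !mem_filter !mem_iota /= !add0n => /andP[_ iH] /andP[_ kH].
        exact: p_inj.
      move=> x /mapP[i]; rewrite mem_filter => /andP[+ iH ->].
      move=> /and3P[ij /same_labelP[iB _ Rij] _].
      rewrite mem_enum !inE (RT i j iB jB Rij ij).2 ps ?Bn // !andbT.
      by apply: contra ij => /eqP/(p_inj _ _ (Bn i iB) jH)->.
    have c4 : #|(T (o j) :&: S) :\ p j| + 1 = #|T (o j) :&: S|.
      by rewrite [RHS](cardsD1 (p j)) inE [_ \in T _]tj pS // addnC.
    have c5 := cardsID S (T (o j)).
    move: c2 c3 c4 c5 (T3 j jB); clear; lia.
  have c6 : #|` L (p j)| <= #|` LS j| + #|Out j|.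
    rewrite -(cardfsID [fset phi x | x in Out j]%fset (L (p j))) addnC leq_add2l.
    apply: leq_trans (leq_card_colors phi (Out j)).
    by apply: fsubset_leq_card; apply: fsubsetIr.
  move: (L6 (p j)) c6; clear; lia.
have [f [fL fE]] := good_target_coloring H0 gt hLS.
have fE' i j : i < size H -> j < size H -> i != j ->
    base_conflict H i j || same_label B l i j -> f i <> f j.
  move=> iH jH ij cij; case: (ltngtP i j) => [lt|gtij|e].
  - exact: fE.
  - move/esym; apply: fE => //.
    case/orP: cij => [/orP[iHj|/hasP[q qH jq]]|/same_labelP[iB jB Rij]].
    + by rewrite /base_conflict Hsym.
    + apply/orP; left; apply/orP; right; apply/hasP; exists q.
        by apply: Hsym => //; apply: (Hlt i).
      exact: Hsym.
    + by rewrite R_same_label ?orbT // Rsym.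
  - by rewrite e eqxx in ij.
have fOut j x : j < size H -> x \in Out j -> f j <> phi x.
  move=> jH xO fx; have := fL j jH; rewrite inE fx => /andP[/negP[]].
  by rewrite in_imfset.
pose psi x := if x \in S then f (index x s) else phi x.
have psip i : i < size H -> psi (p i) = f i.
  by move=> iH; rewrite /psi pS // index_uniq // sz.
have psiN x : x \notin S -> psi x = phi x by rewrite /psi => /negbTE->.
have [phiL phiP _] := dphi.
have psi_adj i x : i < size H -> x \in A -> adj (p i) x -> psi (p i) <> psi x.
  move=> iH xA ix.
  have xnb : x \in nb A (p i) by rewrite inE xA ix.
  have [/Sp[j jH xj]|xS] := boolP (x \in S); last first.
    have [iB ->] := nbD i x iH xnb xS.
    rewrite psip // psiN ?oNs //; apply: fOut => //.
    by rewrite inE iB !inE eqxx orbT.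
  rewrite xj !psip //; apply: fE' => //.
    by apply: contraTneq ix => ->; rewrite xj adj_irrefl.
  move: xnb; rewrite nbP // => /orP[/mapP[q qH xq]|/andP[iB /eqP xo]].
    rewrite /base_conflict (p_inj j q jH (Hlt i q iH qH)) -?xj ?xq //.
    by rewrite qH.
  by have := oNs i iB; rewrite -xo xj pS.
exists psi; apply: (@dyn_on_trios _ _ L _ _ T) => [v vA|v w vA wA vw|v vA].
- have [/Sp[i iH ->]|vS] := boolP (v \in S).
    by rewrite psip //; have := fL i iH; rewrite inE => /andP[].
  by rewrite psiN //; apply: phiL; rewrite inE vS.
- have [/Sp[i iH vi]|vS] := boolP (v \in S).
    by rewrite vi in vw *; apply: psi_adj.
  have [/Sp[i iH wi]|wS] := boolP (w \in S).
    by move/esym; rewrite wi in vw *; apply: psi_adj => //; rewrite adjC.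
  by rewrite !psiN //; apply: phiP; rewrite // inE ?vS ?wS.
have [TX cT injT _] := hT v vA; split=> //.
suff inj' i y : i < size H -> p i \in T v -> y \in T v -> psi (p i) = psi y ->
    p i = y.
  move=> x y xT yT; have [/Sp[i iH xi]|xS] := boolP (x \in S).
    by rewrite xi in xT *; apply: inj'.
  have [/Sp[i iH yi]|yS] := boolP (y \in S).
    by rewrite yi in yT * => /esym; move/(inj' i x iH yT xT).
  by rewrite !psiN //; apply: injT; rewrite inE ?xS ?yS.
move=> iH iT yT; apply: contra_eq => iy.
have := subsetP TX _ iT; have := subsetP TX _ yT.
(* For [v] in [S], a clash is a base conflict or involves the outer neighbor of [v]. For [v] outside
   [S], both vertices lie in one trio, and either share a label or one of them is in [Out i]. *)
have [/Sp[q qH ->{v vA TX cT injT iT yT}]|vS] := boolP (v \in S).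
  move=> ynb inb.
  have iqH : i \in nth [::] H q.
    move: inb; rewrite nbP // => /orP[/mapP[k kH]|/andP[qB /eqP io]].
      by move/(p_inj _ _ iH (Hlt q k qH kH))->.
    by have := oNs q qB; rewrite -io pS.
  move: ynb iy; rewrite nbP // => /orP[/mapP[j jH ->]|/andP[qB /eqP->]] iy.
    have jn := Hlt q j qH jH.
    rewrite !psip //; apply/eqP; apply: fE' => //.
      by apply: contra iy => /eqP->.
    apply/orP; left; apply/orP; right; apply/hasP; exists q => //.
    exact: Hsym.
  rewrite psip // psiN ?oNs //; apply/eqP; apply: fOut => //.
  rewrite inE; apply/orP; left; rewrite inE; apply: map_f.
  by rewrite mem_filter qB Hsym.
have oi k : k < size H -> p k \in T v -> k \in B /\ v = o k.
  move=> kH /(subsetP TX); rewrite inE => /andP[_ vk].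
  by apply: nbD; rewrite // inE vA adjC.
have [iB vo] := oi i iH iT.
have ti : trio i by rewrite /trio -vo.
move=> _ _; have [/Sp[j jH yj]|yS] := boolP (y \in S).
  rewrite yj in yT iy *; rewrite !psip //; apply/eqP; apply: fE' => //.
    by apply: contra iy => /eqP->.
  have [jB vj] := oi j jH yT.
  by rewrite R_same_label ?orbT // /R -vo -vj eqxx ti /trio -vj yT orbT.
rewrite psip // psiN //; apply/eqP; apply: fOut => //.
rewrite inE iB ti -vo; apply/orP; right; apply/setU1P; right.
exact/setDP.
Qed.

End ConfigReducible.

(** * Structure of a minimal counterexample *)

Section Minimal.
Variables (G : sgraph) (C : choiceType) (L : G -> {fset C}).
Hypothesis L6 : forall v, 6 <= #|` L v|.
Variable A : {set G}.
Hypothesis notA : ~ colorable_on L A.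
Hypothesis minA : forall A' : {set G}, A' \proper A -> colorable_on L A'.

Definition dg (v : G) := #|nb A v|.
(* For [dg v = 3], [tw v = k] says that [v] is a [k]-type vertex. *)
Definition tw (v : G) := #|[set x in nb A v | dg x == 2]|.

Lemma nbA v w : w \in nb A v -> w \in A.
Proof. by rewrite inE => /andP[]. Qed.

Lemma nb_sym v w : v \in A -> w \in nb A v -> v \in nb A w.
Proof. by rewrite !inE adj_sym => -> /andP[_ ->]. Qed.

Lemma nb_neq v w : w \in nb A v -> v != w.
Proof. by rewrite inE => /andP[_]; apply: contraTneq => ->; rewrite adj_irrefl. Qed.

Lemma dg_seq v s : nb A v =i s -> uniq s -> dg v = size s.
Proof. by move=> nbE us; rewrite -(card_uniqP us); apply: eq_card. Qed.

Lemma tw_seq v s : nb A v =i s -> uniq s ->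
  tw v = count (fun x => dg x == 2) s.
Proof.
move=> nbE us; rewrite -size_filter -(card_uniqP (filter_uniq _ us)).
by apply: eq_card => x; rewrite inE mem_filter andbC nbE.
Qed.

Lemma config_false H B light ks (x0 : G) (s os : seq G) :
  wf_config H B -> check_config H B light ks ->
  size s = size H -> uniq s -> {subset s <= A} ->
  (forall i, i < size H ->
     nb A (nth x0 s i) =i nbseq H B x0 s os i /\ uniq (nbseq H B x0 s os i)) ->
  (forall i j, i \in B -> j \in B -> nth x0 os i != nth x0 s j) ->
  (forall i, i \in light -> 3 <= #|nb A (nth x0 os i) :\: [set x in s]|) ->
  False.
Proof.
move=> wf chk sz us sA hnb oB hl; apply: notA.
apply: (config_reducible L6 wf chk sz us sA hnb oB hl).
apply: minA; rewrite /proper subsetDl /=.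
have s0 : head x0 s \in s.
  by case/and4P: wf; rewrite -sz; case: (s) => //= x r; rewrite inE eqxx.
apply/subsetPn; exists (head x0 s); first exact: sA.
by rewrite !inE s0.
Qed.

Lemma nb_list v : exists s, [/\ nb A v =i s, uniq s & size s = dg v].
Proof.
by exists (enum (nb A v)); rewrite enum_uniq -cardE; split=> // x; rewrite mem_enum.
Qed.

Lemma nb_list_in v x : x \in nb A v ->
  exists s, [/\ nb A v =i x :: s, uniq (x :: s) & dg v = (size s).+1].
Proof.
move=> xv; exists (rem x (enum (nb A v))).
have us : uniq (x :: rem x (enum (nb A v))).
  by rewrite /= rem_uniq ?enum_uniq // mem_rem_uniq ?enum_uniq // inE eqxx.
have nbE : nb A v =i x :: rem x (enum (nb A v)).
  move=> y; rewrite [RHS]in_cons mem_rem_uniq ?enum_uniq //.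
  rewrite [X in _ || X]inE /= mem_enum.
  by case: eqVneq => [->|].
by split=> //; rewrite (dg_seq nbE us).
Qed.

(** With at most one neighbor, only the colors of that neighbor and of two further members of its
    trio are forbidden. *)
Lemma dg_ge2 v : v \in A -> 1 < dg v.
Proof.
move=> vA; rewrite ltnNge; apply/negP => d1.
have [s [nbE us sz]] := nb_list v.
have sub : {subset [:: v] <= A} by move=> x; rewrite inE => /eqP->.
case: s nbE us sz => [|b [|b' s]] nbE us sz; last by rewrite -sz in d1.
  by apply: (@config_false [:: [::]] [::] [::] [:: [:: 0]] v [:: v] [::]) => // -[].
apply: (@config_false [:: [::]] [:: 0] [::] [:: [:: 0]] v [:: v] [:: b]) => //.
  by case.
move=> i j; rewrite !inE => /eqP-> /eqP->; rewrite /= eq_sym nb_neq //.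
by rewrite nbE inE.
Qed.

(** Each of the two has at most four forbidden colors outside: its outer neighbor, two more members
    of the trio there, and the outer neighbor of the other. Two colors remain for each. *)
Lemma adj_two_vertices u v :
  u \in A -> v \in nb A u -> dg u = 2 -> dg v = 2 -> False.
Proof.
move=> uA vu du dv; have vA := nbA vu.
have [[|x [|? ?]] [nu uu]] := nb_list_in vu; rewrite du => // _.
have [[|y [|? ?]] [nv uv]] := nb_list_in (nb_sym uA vu); rewrite dv => // _.
have := uu; have := uv; rewrite /= !inE !andbT => uy vx.
have ux : u != x by apply: nb_neq; rewrite nu !inE eqxx orbT.
have vy : v != y by apply: nb_neq; rewrite nv !inE eqxx orbT.
apply: (@config_false [:: [:: 1]; [:: 0]] [:: 0; 1] [::] [:: [:: 1; 0]] v
  [:: u; v] [:: x; y]) => //=.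
- by rewrite inE andbT; apply: nb_neq.
- by move=> z; rewrite !inE => /orP[]/eqP->.
- by do 2![case=> [|] //].
- move=> i j; rewrite !inE => /orP[]/eqP-> /orP[]/eqP-> //=;
  by rewrite eq_sym.
Qed.

Lemma two_nb a v : a \in A -> dg a = 2 -> v \in nb A a ->
  exists b, [/\ nb A a =i [:: v; b], uniq [:: v; b] & dg b <> 2].
Proof.
move=> aA da va; have [[|b [|? ?]] [nba ub]] := nb_list_in va; rewrite da => // _.
have ba : b \in nb A a by rewrite nba !inE eqxx orbT.
by exists b; split=> // db; apply: adj_two_vertices ba da db.
Qed.

Lemma no_four_cycle a x y z : a \in A -> dg a = 2 ->
  x \in nb A a -> y \in nb A a -> x != y ->
  z \in A -> z != a -> x \in nb A z -> y \in nb A z -> dg z <= 3 -> False.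
Proof.
move=> aA da xa ya xy zA za xz yz dz; apply: notA.
have [b [nba + _]] := two_nb aA da xa; rewrite /= inE andbT => xb.
have yb : y = b.
  by move: ya; rewrite nba !inE eq_sym (negbTE xy) => /eqP.
apply: (two_vertex_reducible L6 aA nba xb).
  right; exists z => //; split=> //; rewrite -?yb.
    by move: xz; rewrite inE => /andP[].
  by move: yz; rewrite inE => /andP[].
by apply: minA; rewrite properD1.
Qed.

(** Together with [no_four_cycle], this rules out coincidences among the vertices of the larger
    configurations. *)
Lemma no_triangle a x y : a \in A -> dg a = 2 ->
  x \in nb A a -> y \in nb A a -> y \in nb A x -> False.
Proof.
move=> aA da xa ya yx; apply: notA.
have [b [nba + _]] := two_nb aA da xa; rewrite /= inE andbT => xb.
have yb : y = b.
  by move: ya; rewrite nba !inE eq_sym (negbTE (nb_neq yx)) => /eqP.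
apply: (two_vertex_reducible L6 aA nba xb).
  by left; rewrite -yb; move: yx; rewrite inE => /andP[].
by apply: minA; rewrite properD1.
Qed.

Lemma type3_nb t c : dg t = 3 -> tw t = 3 -> c \in nb A t ->
  exists e1 e2, [/\ nb A t =i [:: c; e1; e2], uniq [:: c; e1; e2],
                    dg c = 2, dg e1 = 2 & dg e2 = 2].
Proof.
move=> dt tt ct; have [[|e1 [|e2 [|? ?]]] [nt ut]] := nb_list_in ct;
  rewrite dt => // _.
exists e1, e2; have := tw_seq nt ut; rewrite tt /=.
by case: eqP; case: eqP; case: eqP.
Qed.

Lemma type2_nb v w : dg v = 3 -> tw v = 2 -> w \in nb A v -> dg w <> 2 ->
  exists a1 a2, [/\ nb A v =i [:: w; a1; a2], uniq [:: w; a1; a2],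
                    dg a1 = 2 & dg a2 = 2].
Proof.
move=> dv tv wv dw; have [[|e1 [|e2 [|? ?]]] [nt ut]] := nb_list_in wv;
  rewrite dv => // _.
exists e1, e2; have := tw_seq nt ut; rewrite tv /=.
by case: eqP; case: eqP; case: eqP.
Qed.

Lemma type1_nb w v : dg w = 3 -> tw w = 1 -> v \in nb A w -> dg v <> 2 ->
  exists c z, [/\ nb A w =i [:: c; v; z], uniq [:: c; v; z],
                    dg c = 2 & dg z <> 2].
Proof.
move=> dw twe vw dv; have [[|c [|z [|? ?]]] [nt ut]] := nb_list_in vw;
  rewrite dw => // _.
have := tw_seq nt ut; rewrite twe /=.
case: eqP => // _; case: eqP => [dc|dc]; case: eqP => [dz|dz] // _.
  have pm : perm_eq [:: v; c; z] [:: c; v; z].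
    by apply/permP => P /=; rewrite addnCA.
  exists c, z; split=> // [x|]; first by rewrite nt (perm_mem pm).
  by have := ut; rewrite (perm_uniq pm).
have pm : perm_eq [:: v; c; z] [:: z; v; c].
  by apply/permP => P /=; rewrite !addn0 addnA addnC.
exists z, c; split=> // [x|]; first by rewrite nt (perm_mem pm).
  by have := ut; rewrite (perm_uniq pm).
Qed.

Lemma type1_nb2 w c : dg w = 3 -> tw w = 1 -> c \in nb A w -> dg c = 2 ->
  exists v z, [/\ nb A w =i [:: c; v; z], uniq [:: c; v; z],
                    dg v <> 2 & dg z <> 2].
Proof.
move=> dw twe vw dv; have [[|v [|z [|? ?]]] [nt ut]] := nb_list_in vw;
  rewrite dw => // _.
exists v, z; have := tw_seq nt ut; rewrite twe /= dv eqxx.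
by case: eqP; case: eqP.
Qed.

(** Otherwise [t], [c], [w], [e] would form a four-cycle in which [c] and [e] both have degree 2. *)
Lemma shared_end t c e w : t \in A -> dg t = 3 -> dg c = 2 -> dg e = 2 ->
  c \in nb A t -> e \in nb A t -> e != c -> w \in nb A c -> w != t ->
  w \notin nb A e.
Proof.
move=> tA dt dc de ct et ec wc wt; apply/negP => we.
apply: (@no_four_cycle e t w c) => //; try exact: nbA ct; try exact: nbA et.
- exact: nb_sym et.
- by rewrite eq_sym.
- by rewrite eq_sym.
- exact: nb_sym ct.
- by rewrite dc.
Qed.

(** Most pairs are separated by degree or type, which [congruence] detects. *)
Ltac neqs := repeat match goal with
  | |- is_true (_ && _) => apply/andP; split
  | |- is_true (~~ (_ || _)) => apply/norP; split
  | |- is_true true => done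
  | |- is_true (?x != ?y) => first [assumption | (rewrite eq_sym; assumption)
                                   | (apply/eqP => ?; congruence)]
  end.

(* The exponent vectors passed to [config_false] here and below were found by a
   computer search. *)
Lemma type3_other_end t c w :
  t \in A -> dg t = 3 -> tw t = 3 -> c \in nb A t -> w \in nb A c -> w != t ->
  dg w = 3 /\ tw w = 1.
Proof.
move=> tA dt tt ct wc wt.
have [e1 [e2 [nt ut dc de1 de2]]] := type3_nb dt tt ct.
have cA := nbA ct.
have et1 : e1 \in nb A t by rewrite nt !inE eqxx orbT.
have et2 : e2 \in nb A t by rewrite nt !inE eqxx !orbT.
have tc := nb_sym tA ct.
have [w' [nc uc dw]] := two_nb cA dc tc.
have ww' : w' = w by move: wc; rewrite nc !inE (negbTE wt) => /eqP.
rewrite {w'}ww' in nc uc dw.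
have [f1 [ne1 ue1 df1]] := two_nb (nbA et1) de1 (nb_sym tA et1).
have [f2 [ne2 ue2 df2]] := two_nb (nbA et2) de2 (nb_sym tA et2).
have /and3P[] := ut; rewrite !inE negb_or => /andP[ce1 ce2] e12 _.
have we1 : w \notin nb A e1 by apply: (@shared_end t c); rewrite // eq_sym.
have we2 : w \notin nb A e2 by apply: (@shared_end t c); rewrite // eq_sym.
have wA := nbA wc.
have cw := nb_sym cA wc.
(* If [dg w] exceeded 3, [w] would keep three neighbors outside the configuration, because [c] is
   its only neighbor inside. This makes [c] light. *)
have dw3 : dg w = 3.
  apply/eqP; rewrite eqn_leq; apply/andP; split; last first.
    by rewrite ltn_neqAle dg_ge2 // andbT eq_sym; apply/eqP.
  rewrite leqNgt; apply/negP => dw4.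
  apply: (@config_false [:: [:: 1; 2; 3]; [:: 0]; [:: 0]; [:: 0]]
    [:: 1; 2; 3] [:: 1] [:: [:: 2; 3; 1; 0]] t [:: t; c; e1; e2]
    [:: t; w; f1; f2]).
  - by [].
  - by vm_compute.
  - by [].
  - rewrite /= !inE; neqs.
  - by move=> x; rewrite !inE => /or4P[]/eqP->//; apply: nbA; eassumption.
  - by do 4?[case=> [|] //].
  - move=> i j; rewrite !inE => /or3P[]/eqP-> /or3P[]/eqP-> /=; neqs.
  move=> i; rewrite inE => /eqP-> /=.
  have -> : nb A w :\: [set x in [:: t; c; e1; e2]] = nb A w :\ c.
    apply/setP => x; rewrite in_setD in_setD1 in_set; case xw: (x \in nb A w);
      last by rewrite !andbF.
    have wx := nb_sym wA xw.
    have xt : x != t.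
      apply: contraTneq wx => ->; rewrite nt !inE; neqs.
    have xe1 : x != e1 by apply: contraTneq wx => ->.
    have xe2 : x != e2 by apply: contraTneq wx => ->.
    by rewrite !inE (negbTE xt) (negbTE xe1) (negbTE xe2) !orbF.
  by move: dw4; rewrite /dg (cardsD1 c) cw.
split=> //.
have [[|x1 [|x2 [|? ?]]] [nw uw]] := nb_list_in cw; rewrite dw3 => // _.
(* If [w] is not 1-type, it has a second neighbor [x] of degree 2, and the configuration extended by
   [w] and [x] is reducible. *)
have [//|[x [y [{}nw {}uw dx]]]] : tw w = 1 \/
    exists x y, [/\ nb A w =i [:: c; x; y], uniq [:: c; x; y] & dg x = 2].
  have := tw_seq nw uw; rewrite /= dc eqxx.
  case: eqP => [dx1|_]; first by right; exists x1, x2.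
  case: eqP => [dx2|_]; last by left.
  have pm : perm_eq [:: c; x1; x2] [:: c; x2; x1].
    by apply/permP => P /=; rewrite !addn0 (addnC (P x1)).
  right; exists x2, x1; split=> // [z|]; first by rewrite nw (perm_mem pm).
  by have := uw; rewrite (perm_uniq pm).
have xw : x \in nb A w by rewrite nw !inE eqxx orbT.
have yw : y \in nb A w by rewrite nw !inE eqxx !orbT.
have [x' [nx ux dx']] := two_nb (nbA xw) dx (nb_sym wA xw).
have notw e : w \notin nb A e -> (e \in nb A w) = false.
  by move=> we; apply/negP => /(nb_sym wA) we'; rewrite we' in we.
have /and3P[] := uw; rewrite !inE negb_or => /andP[cx cy] xy _.
have xe1 : x != e1 by apply: contraTneq xw => ->; rewrite notw.
have xe2 : x != e2 by apply: contraTneq xw => ->; rewrite notw.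
have ye1 : y != e1 by apply: contraTneq yw => ->; rewrite notw.
have ye2 : y != e2 by apply: contraTneq yw => ->; rewrite notw.
have fw1 : f1 != w by apply: contraNneq we1 => <-; rewrite ne1 !inE eqxx orbT.
have fw2 : f2 != w by apply: contraNneq we2 => <-; rewrite ne2 !inE eqxx orbT.
have wy := nb_neq yw.
have wx' : w != x' by have := ux; rewrite /= inE andbT.
have [] : False.
apply: (@config_false
  [:: [:: 1; 2; 3]; [:: 0; 4]; [:: 0]; [:: 0]; [:: 1; 5]; [:: 4]]
  [:: 2; 3; 4; 5] [::] [:: [:: 3; 4; 0; 1; 1; 1]] t [:: t; c; e1; e2; w; x]
  [:: t; t; f1; f2; y; x']).
- by [].
- by vm_compute.
- by [].
- rewrite /= !inE; neqs.
- move=> z; rewrite !inE; do ![case/orP] => /eqP->//; apply: nbA; eassumption.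
- by do 6?[case=> [|] //].
- move=> i j; rewrite !inE => /or4P[]/eqP-> /or4P[]/eqP-> /=; neqs.
- by [].
Qed.

(** The two vertices and their four neighbors of degree 2 are reducible. Several exponent vectors
    are supplied; each labeling needs only one that works. *)
Lemma adj_type2 v w : v \in A -> w \in nb A v ->
  dg v = 3 -> tw v = 2 -> dg w = 3 -> tw w = 2 -> False.
Proof.
move=> vA wv dv tv dw twe; have wA := nbA wv; have vw := nb_sym vA wv.
have [|a1 [a2 [nv uv da1 da2]]] := type2_nb dv tv wv; first by rewrite dw.
have [|c1 [c2 [nw uw dc1 dc2]]] := type2_nb dw twe vw; first by rewrite dv.
have a1v : a1 \in nb A v by rewrite nv !inE eqxx orbT.
have a2v : a2 \in nb A v by rewrite nv !inE eqxx !orbT.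
have c1w : c1 \in nb A w by rewrite nw !inE eqxx orbT.
have c2w : c2 \in nb A w by rewrite nw !inE eqxx !orbT.
have [b1 [n1 u1 d1]] := two_nb (nbA a1v) da1 (nb_sym vA a1v).
have [b2 [n2 u2 d2]] := two_nb (nbA a2v) da2 (nb_sym vA a2v).
have [b3 [n3 u3 d3]] := two_nb (nbA c1w) dc1 (nb_sym wA c1w).
have [b4 [n4 u4 d4]] := two_nb (nbA c2w) dc2 (nb_sym wA c2w).
have ac a c : dg a = 2 -> a \in nb A v -> c \in nb A w -> a != c.
  move=> da av cw; apply/eqP => ac; rewrite -ac in cw.
  exact: (no_triangle (nbA av) da (nb_sym vA av) (nb_sym wA cw)).
have ac11 := ac _ _ da1 a1v c1w; have ac12 := ac _ _ da1 a1v c2w.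
have ac21 := ac _ _ da2 a2v c1w; have ac22 := ac _ _ da2 a2v c2w.
have /and3P[_ + _] := uv; rewrite inE => a12.
have /and3P[_ + _] := uw; rewrite inE => c12.
have vNw := nb_neq wv.
apply: (@config_false
  [:: [:: 1; 2; 3]; [:: 0; 4; 5]; [:: 0]; [:: 0]; [:: 1]; [:: 1]]
  [:: 2; 3; 4; 5] [::]
  [:: [:: 2; 3; 1; 2; 2; 1]; [:: 2; 3; 2; 0; 2; 2];
      [:: 0; 3; 4; 2; 0; 2]; [:: 0; 3; 2; 4; 0; 2]]
  v [:: v; w; a1; a2; c1; c2] [:: v; v; b1; b2; b3; b4]).
- by [].
- by vm_compute.
- by [].
- rewrite /= !inE; neqs.
- move=> z; rewrite !inE; do ![case/orP] => /eqP->//; apply: nbA; eassumption.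
- by do 6?[case=> [|] //].
- move=> i j; rewrite !inE => /or4P[]/eqP-> /or4P[]/eqP-> /=; neqs.
- by [].
Qed.

Lemma type1_two_type2 w c v v' : w \in A -> dg w = 3 -> tw w = 1 ->
  nb A w =i [:: c; v; v'] -> uniq [:: c; v; v'] -> dg c = 2 ->
  dg v = 3 -> tw v = 2 -> dg v' = 3 -> tw v' = 2 -> False.
Proof.
move=> wA dw twe nw uw dc dv tv dv' tv'.
have cw : c \in nb A w by rewrite nw !inE eqxx.
have vw : v \in nb A w by rewrite nw !inE eqxx orbT.
have vw' : v' \in nb A w by rewrite nw !inE eqxx !orbT.
have wv := nb_sym wA vw; have wv' := nb_sym wA vw'; have wc := nb_sym wA cw.
have vA := nbA vw; have vA' := nbA vw'; have cA := nbA cw.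
have [|a1 [a2 [nv uv da1 da2]]] := type2_nb dv tv wv; first by rewrite dw.
have [|c1 [c2 [nv' uv' dc1 dc2]]] := type2_nb dv' tv' wv'; first by rewrite dw.
have a1v : a1 \in nb A v by rewrite nv !inE eqxx orbT.
have a2v : a2 \in nb A v by rewrite nv !inE eqxx !orbT.
have c1v : c1 \in nb A v' by rewrite nv' !inE eqxx orbT.
have c2v : c2 \in nb A v' by rewrite nv' !inE eqxx !orbT.
have [b0 [n0 u0 d0]] := two_nb cA dc wc.
have [b1 [n1 u1 d1]] := two_nb (nbA a1v) da1 (nb_sym vA a1v).
have [b2 [n2 u2 d2]] := two_nb (nbA a2v) da2 (nb_sym vA a2v).
have [b3 [n3 u3 d3]] := two_nb (nbA c1v) dc1 (nb_sym vA' c1v).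
have [b4 [n4 u4 d4]] := two_nb (nbA c2v) dc2 (nb_sym vA' c2v).
have /and3P[_ + _] := uw; rewrite inE => vv'.
(* A common neighbor of degree 2 would close a four-cycle through [w]. *)
have ac a b : dg a = 2 -> a \in nb A v -> b \in nb A v' -> a != b.
  move=> da av cv; apply/eqP => ac; rewrite -ac in cv.
  apply: (@no_four_cycle a v v' w) => //; try exact: nbA av.
  - exact: nb_sym av.
  - exact: nb_sym cv.
  - by apply/eqP => wa; congruence.
  - by rewrite dw.
have ca x : x \in nb A w -> forall a, a \in nb A x -> c != a.
  move=> xw a ax; apply/eqP => ca; rewrite -ca in ax.
  exact: (no_triangle cA dc wc (nb_sym (nbA xw) ax) xw).
have ac11 := ac _ _ da1 a1v c1v; have ac12 := ac _ _ da1 a1v c2v.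
have ac21 := ac _ _ da2 a2v c1v; have ac22 := ac _ _ da2 a2v c2v.
have ca1 := ca _ vw _ a1v; have ca2 := ca _ vw _ a2v.
have ca3 := ca _ vw' _ c1v; have ca4 := ca _ vw' _ c2v.
have /and3P[_ + _] := uv; rewrite inE => a12.
have /and3P[_ + _] := uv'; rewrite inE => c12.
apply: (@config_false
  [:: [:: 1; 2; 3]; [:: 0]; [:: 0; 4; 5]; [:: 0; 6; 7];
      [:: 2]; [:: 2]; [:: 3]; [:: 3]]
  [:: 1; 4; 5; 6; 7] [::]
  [:: [:: 4; 2; 1; 3; 1; 2; 2; 1]; [:: 4; 2; 3; 1; 1; 2; 2; 1]]
  w [:: w; c; v; v'; a1; a2; c1; c2] [:: w; b0; w; w; b1; b2; b3; b4]).
- by [].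
- by vm_compute.
- by [].
- rewrite /= !inE; neqs.
- move=> z; rewrite !inE; do ![case/orP] => /eqP->//; apply: nbA; eassumption.
- by do 8?[case=> [|] //].
- move=> i j; rewrite !inE; do ![case/orP] => /eqP->; do ![case/orP] => /eqP-> /=;
    neqs.
- by [].
Qed.

(* The degenerate case of [type3_chain] in which the neighbor of degree 2 of [z]
   is also a neighbor of [t]. *)
Lemma type3_chain_short t c e1 e2 w v z :
  t \in A -> nb A t =i [:: c; e1; e2] -> uniq [:: c; e1; e2] ->
  dg t = 3 -> tw t = 3 -> dg c = 2 -> dg e1 = 2 -> dg e2 = 2 ->
  w \in A -> nb A w =i [:: c; v; z] -> uniq [:: c; v; z] ->
  dg w = 3 -> tw w = 1 -> dg v = 3 -> tw v = 2 -> dg z = 3 -> tw z = 1 ->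
  e1 \in nb A z -> False.
Proof.
move=> tA nt ut dt tt dc de1 de2 wA nw uw dw twe dv tv dz tz e1z.
have ct : c \in nb A t by rewrite nt !inE eqxx.
have et1 : e1 \in nb A t by rewrite nt !inE eqxx orbT.
have et2 : e2 \in nb A t by rewrite nt !inE eqxx !orbT.
have cw : c \in nb A w by rewrite nw !inE eqxx.
have vw : v \in nb A w by rewrite nw !inE eqxx orbT.
have zw : z \in nb A w by rewrite nw !inE eqxx !orbT.
have vA := nbA vw; have zA := nbA zw; have cA := nbA cw.
have wv := nb_sym wA vw; have wz := nb_sym wA zw.
have [|a1 [a2 [nv uv da1 da2]]] := type2_nb dv tv wv; first by rewrite dw.
have a1v : a1 \in nb A v by rewrite nv !inE eqxx orbT.
have a2v : a2 \in nb A v by rewrite nv !inE eqxx !orbT.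
have [b1 [n1 u1 d1]] := two_nb (nbA a1v) da1 (nb_sym vA a1v).
have [b2 [n2 u2 d2]] := two_nb (nbA a2v) da2 (nb_sym vA a2v).
have [|s [z' [nz uz ds dz']]] := type1_nb dz tz wz; first by rewrite dw.
have z'z : z' \in nb A z by rewrite nz !inE eqxx !orbT.
have se1 : s = e1.
  move: e1z; rewrite nz !inE => /or3P[]/eqP e //; congruence.
rewrite {s}se1 in nz uz ds.
have [w' [nc uc _]] := two_nb cA dc (nb_sym tA ct).
have tw' : t <> w by congruence.
have ww' : w' = w.
  by have := nb_sym wA cw; rewrite nc !inE => /orP[]/eqP // /esym.
rewrite {w'}ww' in nc uc.
have [f1 [ne1 ue1 _]] := two_nb (nbA et1) de1 (nb_sym tA et1).
have tz' : t <> z by congruence.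
have fz : f1 = z.
  by have := nb_sym zA e1z; rewrite ne1 !inE => /orP[]/eqP // /esym.
rewrite {f1}fz in ne1 ue1.
have [f2 [ne2 ue2 df2]] := two_nb (nbA et2) de2 (nb_sym tA et2).
have t_end e : e \in nb A t -> forall x, x \in nb A e -> x != t -> tw x = 1.
  by move=> et x xe xt; have [] := type3_other_end tA dt tt et xe xt.
(* A common vertex would have [v] as its end away from [t]; those ends are 1-type, whereas [v] is
   2-type. *)
have ea e a : e \in nb A t -> a \in nb A v -> e != a.
  move=> et av; apply/eqP => ea; rewrite -ea in av.
  have := t_end e et v (nb_sym vA av).
  rewrite tv => h; have : v != t by apply/eqP => vt; congruence.
  by move/h.
have h1 := ea _ _ ct a1v; have h2 := ea _ _ ct a2v.
have h3 := ea _ _ et1 a1v; have h4 := ea _ _ et1 a2v.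
have h5 := ea _ _ et2 a1v; have h6 := ea _ _ et2 a2v.
have /and3P[] := ut; rewrite !inE negb_or => /andP[ce1 ce2] e12 _.
have /and3P[_ + _] := uv; rewrite inE => a12.
have /and3P[_ + _] := uw; rewrite inE => vz.
have wNz := nb_neq zw; have zz' := nb_neq z'z.
(* As [z] belongs to [B] and has degree 3, degrees alone do not separate it from the outer
   neighbors. Adjacency of [z] and [a] would close the four-cycle [v], [a], [z], [w]. *)
have za a : dg a = 2 -> a \in nb A v -> z \notin nb A a.
  move=> da av; apply/negP => zna.
  apply: (@no_four_cycle a v z w) => //; try exact: nbA av.
  - exact: nb_sym av.
  - by apply/eqP => wa; congruence.
  - by rewrite dw.
have b1z : b1 != z.
  by apply: contraNneq (za _ da1 a1v) => <-; rewrite n1 !inE eqxx orbT.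
have b2z : b2 != z.
  by apply: contraNneq (za _ da2 a2v) => <-; rewrite n2 !inE eqxx orbT.
have f2z : f2 != z.
  apply/eqP => fz; have : e2 \in nb A z.
    by apply: nb_sym (nbA et2) _; rewrite ne2 -fz !inE eqxx orbT.
  rewrite nz !inE eq_sym (negbTE e12) /= => /orP[]/eqP e; congruence.
apply: (@config_false
  [:: [:: 1; 2; 3]; [:: 0; 4]; [:: 0; 8]; [:: 0]; [:: 1; 5; 8]; [:: 4; 6; 7];
      [:: 5]; [:: 5]; [:: 2; 4]]
  [:: 3; 6; 7; 8] [::] [:: [:: 4; 5; 3; 0; 4; 1; 2; 1; 1]]
  t [:: t; c; e1; e2; w; v; a1; a2; z] [:: t; t; t; f2; t; t; b1; b2; z']).
- by [].
- by vm_compute.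
- by [].
- rewrite /= !inE; neqs.
- move=> x; rewrite !inE; do ![case/orP] => /eqP->//; apply: nbA; eassumption.
- by do 9?[case=> [|] //].
- move=> i j; rewrite !inE => /or4P[]/eqP-> /or4P[]/eqP-> /=; neqs.
- by [].
Qed.

(** Here [w] would send 3 to [c] and 1 to [v], exceeding its charge 3, without help from [z]. The
    reducible configuration has ten vertices, and nine when the neighbor of degree 2 of [z] is also
    adjacent to [t]. *)
Lemma type3_chain t c w v z :
  t \in A -> dg t = 3 -> tw t = 3 -> c \in nb A t -> dg c = 2 ->
  w \in A -> nb A w =i [:: c; v; z] -> uniq [:: c; v; z] ->
  dg w = 3 -> tw w = 1 -> dg v = 3 -> tw v = 2 -> dg z = 3 -> tw z = 1 -> False.
Proof.
move=> tA dt tt ct dc wA nw uw dw twe dv tv dz tz.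
have [e1 [e2 [nt ut _ de1 de2]]] := type3_nb dt tt ct.
have [e1z|e1z] := boolP (e1 \in nb A z).
  exact: (@type3_chain_short t c e1 e2 w v z).
have [e2z|e2z] := boolP (e2 \in nb A z).
  have pm : perm_eq [:: c; e1; e2] [:: c; e2; e1].
    by apply/permP => P /=; rewrite !addn0 (addnC (P e1)).
  apply: (@type3_chain_short t c e2 e1 w v z) => // [x|].
    by rewrite nt (perm_mem pm).
  by have := ut; rewrite (perm_uniq pm).
have et1 : e1 \in nb A t by rewrite nt !inE eqxx orbT.
have et2 : e2 \in nb A t by rewrite nt !inE eqxx !orbT.
have cw : c \in nb A w by rewrite nw !inE eqxx.
have vw : v \in nb A w by rewrite nw !inE eqxx orbT.
have zw : z \in nb A w by rewrite nw !inE eqxx !orbT.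
have vA := nbA vw; have zA := nbA zw; have cA := nbA cw.
have wv := nb_sym wA vw; have wz := nb_sym wA zw.
have [|a1 [a2 [nv uv da1 da2]]] := type2_nb dv tv wv; first by rewrite dw.
have a1v : a1 \in nb A v by rewrite nv !inE eqxx orbT.
have a2v : a2 \in nb A v by rewrite nv !inE eqxx !orbT.
have [b1 [n1 u1 d1]] := two_nb (nbA a1v) da1 (nb_sym vA a1v).
have [b2 [n2 u2 d2]] := two_nb (nbA a2v) da2 (nb_sym vA a2v).
have [|s [z' [nz uz ds dz']]] := type1_nb dz tz wz; first by rewrite dw.
have z'z : z' \in nb A z by rewrite nz !inE eqxx !orbT.
have sz : s \in nb A z by rewrite nz !inE eqxx.
have [s' [ns us ds']] := two_nb (nbA sz) ds (nb_sym zA sz).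
have [w' [nc uc _]] := two_nb cA dc (nb_sym tA ct).
have tw' : t <> w by congruence.
have ww' : w' = w.
  by have := nb_sym wA cw; rewrite nc !inE => /orP[]/eqP // /esym.
rewrite {w'}ww' in nc uc.
have [f1 [ne1 ue1 df1]] := two_nb (nbA et1) de1 (nb_sym tA et1).
have [f2 [ne2 ue2 df2]] := two_nb (nbA et2) de2 (nb_sym tA et2).
have ea e a : e \in nb A t -> a \in nb A v -> e != a.
  move=> et av; apply/eqP => ea; rewrite -ea in av.
  have vt : v != t by apply/eqP => vt; congruence.
  have [_] := type3_other_end tA dt tt et (nb_sym vA av) vt.
  by rewrite tv.
have h1 := ea _ _ ct a1v; have h2 := ea _ _ ct a2v.
have h3 := ea _ _ et1 a1v; have h4 := ea _ _ et1 a2v.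
have h5 := ea _ _ et2 a1v; have h6 := ea _ _ et2 a2v.
have /and3P[] := ut; rewrite !inE negb_or => /andP[ce1 ce2] e12 _.
have /and3P[_ + _] := uv; rewrite inE => a12.
have /and3P[_ + _] := uw; rewrite inE => vz.
have wNz := nb_neq zw; have zz' := nb_neq z'z.
have se1 : s != e1 by apply: contraNneq e1z => <-.
have se2 : s != e2 by apply: contraNneq e2z => <-.
have sc : s != c.
  apply: contraTneq (nb_sym zA sz) => ->; rewrite nc !inE.
  by apply/norP; split; neqs.
have za a : dg a = 2 -> a \in nb A v -> z \notin nb A a.
  move=> da av; apply/negP => zna.
  apply: (@no_four_cycle a v z w) => //; try exact: nbA av.
  - exact: nb_sym av.
  - by apply/eqP => wa; congruence.
  - by rewrite dw.
have sa a : dg a = 2 -> a \in nb A v -> s != a.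
  by move=> da av; apply: contraNneq (za a da av) => <-; apply: nb_sym.
have sa1 := sa _ da1 a1v; have sa2 := sa _ da2 a2v.
have b1z : b1 != z.
  by apply: contraNneq (za _ da1 a1v) => <-; rewrite n1 !inE eqxx orbT.
have b2z : b2 != z.
  by apply: contraNneq (za _ da2 a2v) => <-; rewrite n2 !inE eqxx orbT.
have f1z : f1 != z.
  apply: contraNneq e1z => <-; apply: nb_sym (nbA et1) _.
  by rewrite ne1 !inE eqxx orbT.
have f2z : f2 != z.
  apply: contraNneq e2z => <-; apply: nb_sym (nbA et2) _.
  by rewrite ne2 !inE eqxx orbT.
have zs' : z != s' by have := us; rewrite /= inE andbT.
apply: (@config_false
  [:: [:: 1; 2; 3]; [:: 0; 4]; [:: 0]; [:: 0]; [:: 1; 5; 8]; [:: 4; 6; 7];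
      [:: 5]; [:: 5]; [:: 9; 4]; [:: 8]]
  [:: 2; 3; 6; 7; 8; 9] [::] [:: [:: 2; 5; 0; 2; 4; 3; 0; 2; 1; 1]]
  t [:: t; c; e1; e2; w; v; a1; a2; z; s]
  [:: t; t; f1; f2; t; t; b1; b2; z'; s']).
- by [].
- by vm_compute.
- by [].
- rewrite /= !inE; neqs.
- move=> x; rewrite !inE; do ![case/orP] => /eqP->//; apply: nbA; eassumption.
- by do 10?[case=> [|] //].
- move=> i j; rewrite !inE; do ![case/orP] => /eqP->; do ![case/orP] => /eqP-> /=;
    neqs.
- by [].
Qed.

(** * Discharging *)

Definition type3 u := (dg u == 3) && (tw u == 3).

Definition give u v :=
  if dg u <= 2 then 0
  else if dg v == 2 then
    if type3 u then 1
    else if [exists x in nb A v, (x != u) && type3 x] then 3 else 2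
  else if dg v == 3 then
    ((3 < dg u) || (tw u == 0) || (tw u == 1) && (tw v == 2) : nat)
  else 0.

Lemma sum_nb v s (F : G -> nat) : nb A v =i s -> uniq s ->
  \sum_(u in nb A v) F u = \sum_(u <- s) F u.
Proof. by move=> nbE us; rewrite big_uniq //=; apply: eq_bigl. Qed.

Lemma give_le1 u v : dg v <> 2 -> give u v <= 1.
Proof.
rewrite /give => /eqP/negbTE->; case: ifP => // _; case: ifP => // _.
exact: leq_b1.
Qed.

Lemma give_le3 u v : give u v <= 3.
Proof. by rewrite /give; do !case: ifP => //; case: (_ || _). Qed.

Lemma type3_otherP u v : u \in A -> v \in nb A u ->
  [exists x in nb A v, (x != u) && type3 x] -> dg u = 3 /\ tw u = 1.
Proof.
move=> uA vu /exists_inP[x xv /andP[xu /andP[/eqP dx /eqP tx]]].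
apply: (type3_other_end (nbA xv) dx tx (nb_sym (nbA vu) xv)).
  exact: nb_sym.
by rewrite eq_sym.
Qed.

(** Sending 3 requires a 3-type vertex at the other end of [v], and by [type3_other_end] the sender
    is then 1-type of degree 3. *)
Lemma give_le2 u v : u \in A -> v \in nb A u -> tw u != 1 \/ dg u != 3 ->
  give u v <= 2.
Proof.
move=> uA vu hu; rewrite /give; case: ifP => // _.
case: ifP => [_|_]; last by case: ifP => // _; case: (_ || _).
case: ifP => // _; case: ifP => // /(type3_otherP uA vu)[d3 t1].
by case: hu; rewrite ?d3 ?t1.
Qed.

Lemma type3_nb_two u v : dg u = 3 -> tw u = 3 -> v \in nb A u -> dg v = 2.
Proof. by move=> du tu vu; have [? [? []]] := type3_nb du tu vu. Qed.

Lemma tw_le_dg u : tw u <= dg u.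
Proof. by apply: subset_leq_card; apply/subsetP => x; rewrite inE => /andP[]. Qed.

Lemma dg_ge3 v : v \in A -> dg v <> 2 -> 2 < dg v.
Proof. by move=> vA dv; rewrite ltn_neqAle dg_ge2 // andbT eq_sym; apply/eqP. Qed.

(** A 2-type vertex has charge 3 but may send 2 + 2, so it needs 1 from its third neighbor. That
    neighbor is not 2-type by [adj_type2], and not 3-type because [v] has degree 3. *)
Lemma give_to_type2 v w : v \in A -> w \in nb A v -> dg v = 3 -> tw v = 2 ->
  dg w <> 2 -> 0 < give w v.
Proof.
move=> vA wv dv tv dw; have wA := nbA wv; have d3 := dg_ge3 wA dw.
rewrite /give [dg w <= 2]leqNgt d3 /= dv /= tv.
have [//|d3'] := ltnP 3 (dg w).
have {d3 d3'} d3 : dg w = 3 by apply/eqP; rewrite eqn_leq d3' d3.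
have := tw_le_dg w; rewrite d3.
case E: (tw w) => [|[|[|[|n]]]] //= _.
- by case: (adj_type2 vA wv dv tv d3 E).
- by have := type3_nb_two d3 E (nb_sym vA wv); rewrite dv.
Qed.

(** Sending 2 to [c] and 1 to [v] uses up the charge 3. If [c] takes 3, the missing unit comes from
    [z]: it cannot be 1-type by [type3_chain] nor 2-type by [type1_two_type2]. *)
Lemma discharge_type1 w c v z : w \in A -> nb A w =i [:: c; v; z] ->
  uniq [:: c; v; z] -> dg w = 3 -> tw w = 1 -> dg c = 2 -> dg v = 3 ->
  tw v = 2 -> dg z <> 2 ->
  18 + \sum_(u in nb A w) give w u <= 7 * dg w + \sum_(u in nb A w) give u w.
Proof.
move=> wA nw uw dw twe dc dv tv dz; rewrite !(sum_nb _ nw uw) !big_cons !big_nil.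
have cw : c \in nb A w by rewrite nw !inE eqxx.
have zw : z \in nb A w by rewrite nw !inE eqxx !orbT.
have zA := nbA zw; have wz := nb_sym wA zw.
have z2 : dg z = 3 -> tw z <> 2.
  by move=> dz3 tz; apply: (type1_two_type2 wA dw twe nw uw dc dv tv dz3 tz).
have gz : give w z = 0.
  rewrite /give dw /= ifF; last exact/eqP.
  case: eqP => // dz3; rewrite twe /=.
  by case: eqP => // /(z2 dz3).
have gv : give w v <= 1 by apply: give_le1; rewrite dv.
have gc2 : ~~ [exists x in nb A c, (x != w) && type3 x] -> give w c <= 2.
  by move=> /negbTE h; rewrite /give dw /= dc /= h; case: ifP.
case: (boolP [exists x in nb A c, (x != w) && type3 x]) => [ex|/gc2 gc].
  suff gzw : 0 < give z w.
    move: (give_le3 w c) gv gzw; rewrite gz dw.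
    move: (give w c) (give w v) (give z w) (give c w) (give v w).
    by clear; lia.
  have d3 := dg_ge3 zA dz.
  rewrite /give [dg z <= 2]leqNgt d3 /= dw /= twe.
  have [//|d3'] := ltnP 3 (dg z).
  have {d3 d3'} d3 : dg z = 3 by apply/eqP; rewrite eqn_leq d3' d3.
  have := tw_le_dg z; rewrite d3.
  case E: (tw z) => [|[|[|[|n]]]] //= _.
  - case/exists_inP: ex => t tc /andP[tw_ /andP[/eqP dt /eqP tt]].
    case: (@type3_chain t c w v z) => //; first exact: nbA tc.
    exact: nb_sym (nbA cw) tc.
  - by case: (z2 d3).
  - by have := type3_nb_two d3 E wz; rewrite dw.
move: gc gv; rewrite gz dw.
move: (give w c) (give w v) (give z w) (give c w) (give v w).
by clear; lia.
Qed.

(** Nonnegativity of the final charge, arranged so that no subtraction of natural numbers occurs. *)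
Lemma discharge v : v \in A ->
  18 + \sum_(u in nb A v) give v u <= 7 * dg v + \sum_(u in nb A v) give u v.
Proof.
move=> vA; have d2 := dg_ge2 vA.
have [dv|dv] := ltnP 3 (dg v).
  (* Every neighbor gets at most 2, and [5 * d >= 18] for [d >= 4]. *)
  apply: (@leq_trans (7 * dg v)); last exact: leq_addr.
  have : \sum_(u in nb A v) give v u <= 2 * dg v.
    rewrite mulnC -sum_nat_const; apply: leq_sum => u uv.
    by apply: give_le2 => //; right; rewrite neq_ltn dv orbT.
  by move: (\sum_(u in nb A v) give v u) (dg v) dv; clear; lia.
move: dv; rewrite leq_eqVlt => /predU1P[dv|dv]; last first.
  have {d2 dv} dv : dg v = 2 by apply/eqP; rewrite eqn_leq d2 -ltnS dv.
  (* The deficit 4 is covered as 2 + 2 or 1 + 3; two 3-type ends are excluded by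
     [type3_other_end]. *)
  rewrite [X in 18 + X]big1 => [|u _]; last by rewrite /give dv.
  have [s [nv uv]] := nb_list v; rewrite dv; case: s nv uv => [|x [|y [|]]] // nv uv _.
  have xv : x \in nb A v by rewrite nv !inE eqxx.
  have yv : y \in nb A v by rewrite nv !inE eqxx orbT.
  have := uv; rewrite /= inE andbT => xy.
  have yx : y != x by rewrite eq_sym.
  have [xA yA] := (nbA xv, nbA yv).
  have big u : u \in nb A v -> (dg u <= 2) = false.
    move=> un; apply/negbTE; rewrite -ltnNge dg_ge3 ?(nbA un) //.
    exact: adj_two_vertices un dv.
  have gE u u' : u \in nb A v -> u' \in nb A v -> u' != u ->
      (forall x, x \in nb A v -> x = u \/ x = u') ->
      give u v = if type3 u then 1 else if type3 u' then 3 else 2.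
    move=> un un' uu' nuu; rewrite /give big // dv /=; case: ifP => // _.
    suff -> : [exists x in nb A v, (x != u) && type3 x] = type3 u' by [].
    apply/exists_inP/idP => [[q /nuu[]-> /andP[]]|tu']; first by rewrite eqxx.
      by [].
    by exists u'; rewrite // uu'.
  rewrite (sum_nb _ nv uv) !big_cons big_nil addn0.
  rewrite (gE x y) //; last first.
    by move=> q; rewrite nv !inE => /orP[]/eqP->; [left|right].
  rewrite (gE y x) //; last first.
    by move=> q; rewrite nv !inE => /orP[]/eqP->; [right|left].
  case tx : (type3 x); case ty : (type3 y) => //.
  move: tx ty => /andP[/eqP dx /eqP tx] /andP[_ /eqP ty].
  have [_] := type3_other_end xA dx tx (nb_sym vA xv) yv yx.
  by rewrite ty.
(* Degree 3 leaves charge 3. The cases 0-type and 3-type send at most 1 to each neighbor; the other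
   two need the lemmas above. *)
case E : (tw v) (tw_le_dg v) => [|[|[|[|n]]]]; rewrite dv // => _.
- apply: (@leq_trans (7 * 3)); last exact: leq_addr.
  have : \sum_(u in nb A v) give v u <= 1 * dg v.
    rewrite mulnC -sum_nat_const; apply: leq_sum => u uv.
    apply: give_le1 => du.
    have : u \in [set x in nb A v | dg x == 2] by rewrite inE uv du eqxx.
    by rewrite (cards0_eq E) inE.
  by rewrite dv; move: (\sum_(u in nb A v) give v u); clear; lia.
- have [c] : exists c, c \in [set x in nb A v | dg x == 2].
    by apply/card_gt0P; rewrite -/(tw v) E.
  rewrite inE => /andP[cv /eqP dc].
  have [y [z [nv uv dy dz]]] := type1_nb2 dv E cv dc.
  have pm : perm_eq [:: c; y; z] [:: c; z; y].
    by apply/permP => P /=; rewrite !addn0 (addnC (P y)).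
  suff : 18 + \sum_(u in nb A v) give v u
         <= 7 * dg v + \sum_(u in nb A v) give u v by rewrite dv.
  case: (boolP ((dg y == 3) && (tw y == 2))) => [/andP[/eqP dy3 /eqP ty]|ny].
    exact: (discharge_type1 vA nv uv).
  case: (boolP ((dg z == 3) && (tw z == 2))) => [/andP[/eqP dz3 /eqP tz]|nz].
    apply: (@discharge_type1 v c z y) => // [q|].
      by rewrite nv (perm_mem pm).
    by have := uv; rewrite (perm_uniq pm).
  have g0 u : dg u <> 2 -> ~~ ((dg u == 3) && (tw u == 2)) -> give v u = 0.
    move=> /eqP/negbTE du nu; rewrite /give dv du /=.
    by case: eqP nu => //= _ /negbTE->; rewrite E.
  apply: (@leq_trans (7 * dg v)); last exact: leq_addr.
  rewrite (sum_nb _ nv uv) !big_cons big_nil (g0 y) // (g0 z) // dv.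
  by move: (give_le3 v c); move: (give v c); clear; lia.
- have [w wv dw] : exists2 w, w \in nb A v & dg w <> 2.
    have /subsetPn[w wv] : ~~ (nb A v \subset [set x in nb A v | dg x == 2]).
      by apply/negP => /subset_leq_card; rewrite -/(tw v) -/(dg v) E dv.
    by rewrite inE wv => /eqP dw; exists w.
  have [a1 [a2 [nv uv da1 da2]]] := type2_nb dv E wv dw.
  have a1v : a1 \in nb A v by rewrite nv !inE eqxx orbT.
  have a2v : a2 \in nb A v by rewrite nv !inE eqxx !orbT.
  have t1 : tw v != 1 \/ dg v != 3 by left; rewrite E.
  have gw : give v w = 0.
    by rewrite /give dv E /=; move/eqP/negbTE: dw => ->; case: ifP.
  rewrite !(sum_nb _ nv uv) !big_cons !big_nil gw.
  move: (give_le2 vA a1v t1) (give_le2 vA a2v t1) (give_to_type2 vA wv dv E dw).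
  move: (give v a1) (give v a2) (give w v) (give a1 v) (give a2 v).
  by clear; lia.
- apply: (@leq_trans (7 * 3)); last exact: leq_addr.
  have : \sum_(u in nb A v) give v u <= 1 * dg v.
    rewrite mulnC -sum_nat_const; apply: leq_sum => u uv.
    by rewrite /give dv (type3_nb_two dv E uv) /type3 dv E.
  by rewrite dv; move: (\sum_(u in nb A v) give v u); clear; lia.
Qed.

Lemma discharging : 18 * #|A| <= 7 * \sum_(v in A) dg v.
Proof.
have swap : \sum_(v in A) \sum_(u in nb A v) give u v
          = \sum_(v in A) \sum_(u in nb A v) give v u.
  rewrite (exchange_big_dep (mem A)) /=; last first.
    by move=> v u _; rewrite inE => /andP[].
  by apply: eq_bigr => u uA; apply: eq_bigl => v; rewrite !inE adj_sym uA.
have : \sum_(v in A) (18 + \sum_(u in nb A v) give v u)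
       <= \sum_(v in A) (7 * dg v + \sum_(u in nb A v) give u v).
  by apply: leq_sum => v; apply: discharge.
rewrite [X in X <= _]big_split [X in _ <= X]big_split /= swap leq_add2r.
by rewrite sum_nat_const big_distrr /= mulnC.
Qed.

End Minimal.

(** * Degree sums and the maximum average degree *)

Lemma mad_degree_sum (G : sgraph) (A : {set G}) :
  (mad G < 18%:R / 7%:R)%R -> A != set0 ->
  7 * \sum_(v in A) #|nb A v| < 18 * #|A|.
Proof.
move=> hmad A0.
pose P := [set p : G * G | [&& p.1 \in A, p.2 \in A & adj p.1 p.2]].
pose ends (p : G * G) := [set p.1; p.2].
have sumP : \sum_(v in A) #|nb A v| = #|P|.
  under eq_bigr do rewrite -sum1_card.
  rewrite pair_big_dep /= sum1_card; apply: eq_card => -[u v].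
  by rewrite [RHS]inE unfold_in /= inE.
(* The map [ends] forgets the order, so each fiber has at most two elements. *)
have leP : #|P| <= 2 * #|ends @: P|.
  rewrite -sum1_card (partition_big_imset ends) /= mulnC -sum_nat_const.
  apply: leq_sum => e /imsetP[[a b] _ ->].
  rewrite sum1dep_card.
  apply: (@leq_trans #|[set (a, b); (b, a)]|); last first.
    by rewrite cards2; case: (_ != _).
  apply/subset_leq_card/subsetP => -[u v]; rewrite !inE /=.
  move=> /andP[/and3P[_ _ uv] /eqP /setP euv].
  have uNv : u != v by apply: contraTneq uv => ->; rewrite adj_irrefl.
  have := euv u; have := euv v; rewrite !inE !eqxx orbT /=.
  move=> /esym/orP[]/eqP va /esym/orP[]/eqP ub; subst; rewrite ?eqxx ?orbT //;
    by rewrite eqxx in uNv.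
have sub : is_subgraph (A, ends @: P) && ((A, ends @: P).1 != set0).
  rewrite A0 andbT; apply/andP; split=> /=.
    apply/imsetS/subsetP => p; rewrite !inE => /and3P[_ _ //].
  apply/bigcupsP => e /imsetP[p]; rewrite inE => /and3P[p1 p2 _] ->.
  by apply/subsetP => x; rewrite !inE => /orP[]/eqP->.
have le_mad : (2%:R * #|ends @: P|%:R / #|A|%:R <= mad G)%R.
  by rewrite /mad; apply: bigmax_sup; first exact: sub; rewrite lexx.
have A_gt0 : (0 < #|A|%:R :> rat)%R by rewrite ltr0n card_gt0.
have := le_lt_trans le_mad hmad; rewrite ltr_pdivrMr // mulrAC ltr_pdivlMr ?ltr0n //.
rewrite -!natrM ltr_nat => h; apply: leq_ltn_trans h.
by rewrite sumP mulnC leq_mul2r leP orbT.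
Qed.

Theorem theorem1p3 (G : sgraph) (hmad : (mad G < 18%:R / 7%:R)%R) :
  list_dynamic_chromatic_number G 3 <= 6.
Proof.
suff choosable : dynamic_choosable G 3 6.
  rewrite /list_dynamic_chromatic_number; case: ex_minnP => m _; apply.
  exact/asboolP.
move=> C L L6.
have colorable (A : {set G}) : colorable_on L A.
  elim: {A}_.+1 {-2}A (ltnSn #|A|) => // n IHn A; rewrite ltnS => An.
  apply: contrapT => notA.
  have minA (A' : {set G}) : A' \proper A -> colorable_on L A'.
    by move/proper_card => lt; apply: IHn; apply: leq_trans lt An.
  have [A0|A0] := eqVneq A set0; last first.
    have := mad_degree_sum hmad A0.
    by rewrite ltnNge (discharging L6 notA minA).
  (* For empty [A] any choice from the lists works; a total function is still required. *)
  apply: notA; have /fin_all_exists[phi hphi] : forall v : G, exists c, c \in L v.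
    by move=> v; apply/fset0Pn; rewrite -cardfs_gt0; apply: leq_trans (L6 v).
  by exists phi; split=> v; rewrite A0 inE.
have [phi [phiL phiP phiD]] := colorable setT.
exists phi; split; last by move=> v; apply: phiL; rewrite inE.
have nbT v : nb [set: G] v = neighbors v by apply/setP => w; rewrite !inE.
split=> [v w vw|v]; first by apply: phiP; rewrite ?inE.
by rewrite /degree -nbT; apply: phiD; rewrite inE.
Qed.
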